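(* Let $L=(l_1,\dots,l_m)$ be the (non-increasing) segment sequence of some unicyclic graph, with $l_1\geq 3$. (a) If $L$ contains an even entry $l_i\geq 3$, and $l_{i_0}$ is the smallest such even entry, then $\sigma(U_{i_0}(l_1,\dots,l_m))\geq \sigma(G)$ for every $G\in\mathbb{U}(l_1,\dots,l_m)$. (b) If every entry $l_i\geq 3$ of $L$ is odd, then $\sigma(U_1(l_1,\dots,l_m))\geq\sigma(G)$ for every $G\in\mathbb{U}(l_1,\dots,l_m)$. In each case, equality holds if the two compared graphs are isomorphic.
   Context: A unicyclic graph is a connected graph containing exactly one cycle. A segment of a graph $G$ is a path whose end vertices each have degree $1$ or at least $3$ in $G$ and whose internal vertices all have degree $2$ in $G$; its length is its number of edges; the segment sequence of $G$ is the non-increasing sequence of its segment lengths; $\mathbb{U}(l_1,\dots,l_m)$ is the set of unicyclic graphs with segment sequence $(l_1,\dots,l_m)$. For $l_i\geq 3$, $U_i(l_1,\dots,l_m)$ is the graph obtained from the cycle $C_{l_i}$ by attaching, at one common vertex of the cycle, pendent paths of lengths $l_j$ for all $j\neq i$ (a pendent path of length $\ell$ at $w$ consists of $\ell$ new vertices $x_1,\dots,x_\ell$ and edges $wx_1,\dots,x_{\ell-1}x_\ell$). $\sigma(G)$ (the Merrifield–Simmons index) is the number of independent vertex subsets of $G$, including the empty set. *)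

(* Defs.v *)
From mathcomp Require Import all_boot all_order.
Set Implicit Arguments. Unset Strict Implicit. Unset Printing Implicit Defensive.

Record sgraph := SGraph {
  gV : finType;
  gadj : rel gV;
  gsym : symmetric gadj;
  girr : irreflexive gadj }.

Section Graph.
Variable G : sgraph.
Local Notation V := (gV G).
Local Notation adj := (@gadj G).

Definition deg (v : V) : nat := #|[set w | adj v w]|.

Definition edges : {set {set V}} :=
  [set e : {set V} | [exists x, exists y, adj x y && (e == [set x; y])]].

Definition connected : bool := [forall x, forall y, connect adj x y].

(* A cycle (as a subgraph, given by its edge set): a nonempty set of edges of G
   forming a connected 2-regular subgraph. *)
Definition is_cycle (F : {set {set V}}) : bool :=
  [&& F \subset edges, F != set0,
      [forall v, (#|[set e in F | v \in e]| == 0) || (#|[set e in F | v \in e]| == 2)]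
    & [forall x, forall y,
        (#|[set e in F | x \in e]| == 2) ==> (#|[set e in F | y \in e]| == 2) ==>
        connect [rel a b | [set a; b] \in F] x y]].

Definition unicyclic : bool := connected && (#|[set F | is_cycle F]| == 1).

Definition walk_edges (s : seq V) : seq {set V} :=
  [seq [set p.1; p.2] | p <- zip s (behead s)].

Definition is_walk (s : seq V) : bool :=
  if s is x :: s' then path adj x s' else false.

Definition internal (s : seq V) : seq V := drop 1 (take (size s - 1) s).

(* A segment: a path (possibly closed, as for the cycle of a unicyclic graph with
   one vertex of degree >= 3) with at least one edge, no repeated edge, distinct
   internal vertices all of degree 2, and end vertices of degree 1 or >= 3
   (i.e. degree <> 2; degree 0 is impossible for an end of an edge). *)
Definition ends_ok (s : seq V) : bool :=
  if s is x :: s' then (deg x != 2) && (deg (last x s') != 2) else false.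

Definition is_segment (s : seq V) : bool :=
  [&& 2 <= size s, is_walk s, uniq (walk_edges s), uniq (internal s),
      all (fun v => deg v == 2) (internal s) & ends_ok s].

(* The segment sequence: L is the non-increasing list of the lengths (numbers of
   edges) of all segments of G, each segment (identified by its edge set, so a
   path and its reversal are the same segment) counted once. *)
Definition has_segseq (L : seq nat) : Prop :=
  sorted geq L /\
  exists Fs : seq {set {set V}},
    [/\ uniq Fs,
        (forall F, F \in Fs <-> exists s, is_segment s /\ [set:: walk_edges s] = F)
      & perm_eq (map (fun F : {set {set V}} => #|F|) Fs) L].

Definition sigma : nat :=
  #|[set S : {set V} | [forall x in S, forall y in S, ~~ adj x y]]|.
End Graph.

Definition isomorphic (G H : sgraph) : Prop :=
  exists f : gV G -> gV H, bijective f /\ forall x y, @gadj H (f x) (f y) = @gadj G x y.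

(* The graph U_i(L) (i is 0-based: U_{i+1} in the paper's notation).
   Vertices 0..sumn L - 1. Cycle on 0..c-1 with c = L_i; pendent paths of
   lengths L_j (j <> i) attached at vertex 0, occupying consecutive blocks. *)
Section U.
Variables (L : seq nat) (i : nat).
Definition Uc := nth 0 L i.
Definition Urest := take i L ++ drop i.+1 L.
Definition Ude (x y : nat) : bool :=
  [&& x < Uc, y < Uc & y == x.+1 %% Uc] ||
  has (fun j => let o := Uc + sumn (take j Urest) in let p := nth 0 Urest j in
               [&& x == 0, y == o & 0 < p] || [&& o <= x, x.+1 == y & y < o + p])
      (iota 0 (size Urest)).
Definition Uadj : rel 'I_(sumn L) :=
  fun x y => (val x != val y) && (Ude x y || Ude y x).
Lemma Uadj_sym : symmetric Uadj.
Proof. by move=> x y; rewrite /Uadj eq_sym orbC. Qed.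
Lemma Uadj_irr : irreflexive Uadj.
Proof. by move=> x; rewrite /Uadj eqxx. Qed.
Definition U : sgraph := SGraph Uadj_sym Uadj_irr.
End U.

(* Main.v *)
Require Import Defs.
From mathcomp Require Import all_boot.
From mathcomp Require Import zify.
Set Implicit Arguments. Unset Strict Implicit. Unset Printing Implicit Defensive.

(** Summing out the interior of every segment writes [sigma G] as a sum over the
    sets [S] of vertices of degree other than 2 of a product of Fibonacci weights,
    one per segment. Contracting a segment [rv] and re-attaching it as a pendent path at
    the merged vertex does not decrease this sum as long as no other segment of
    length 1 joins [r] and [v]: the difference counts the independent sets of the
    rest that meet the neighbourhoods of both [r] and [v]. The graph of segments of a
    unicyclic graph is a spanning tree plus one segment [xy]. If [x = y], contracting
    the tree gives [U_i] for some [i]. Otherwise contract every tree segment except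
    the one above [y]; there remain two vertices joined by two segments, of lengths
    [c] and [d], with pendent paths. If [c] or [d] is at least 3, contracting the
    other one gives some [U_i]; if both are at most 2, there is a pendent path of
    length at least 3, and turning it into the cycle increases the value. Finally,
    the [U_i] are compared with each other by d'Ocagne's identity. *)

(** * Fibonacci weights *)

Fixpoint fib n := match n with
  | 0 => 0
  | n'.+1 => match n' with 0 => 1 | n''.+1 => fib n' + fib n'' end
  end.

Lemma fibSS n : fib n.+2 = fib n.+1 + fib n. Proof. by []. Qed.

Arguments fib : simpl never.

Lemma leq_fib n : fib n <= fib n.+1.
Proof. by case: n => // n; rewrite fibSS leq_addr. Qed.

(** By d'Ocagne's identity, [fib a.+1 * fib (a + k) - fib a * fib (a + k).+1] equals [fib k] with
    the sign of [(-1)^a]. Only the sign is kept; it flips at each induction step. *)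
Lemma fib_docagne k a :
  (odd a -> fib a.+1 * fib (a + k) <= fib a * fib (a + k).+1) /\
  (~~ odd a -> fib a * fib (a + k).+1 <= fib a.+1 * fib (a + k)).
Proof.
elim: a => [|a [IHo IHe]]; first by split; rewrite ?mul0n.
split=> /= ha.
  have := IHe ha.
  rewrite !addSn (fibSS a) (fibSS (a + k)) mulnDl mulnDr; lia.
have := IHo (negPn ha).
rewrite !addSn (fibSS a) (fibSS (a + k)) mulnDl mulnDr; lia.
Qed.

(* The number of independent subsets of the interior of a path of length [l]
   that are compatible with the states [x] and [y] of its two ends; for [l = 0]
   the truncated [l.-1] makes it meaningless. *)
Definition transfer l (x y : bool) :=
  if x && y then fib l.-1 else if x || y then fib l else fib l.+1.

Definition pendant l x := transfer l x false + transfer l x true.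

Lemma transferC l x y : transfer l x y = transfer l y x.
Proof. by rewrite /transfer andbC orbC. Qed.

(** Splits on the state of the neighbour of the end [x]. The length is [l.+2] so that the remaining
    path still has positive length, where [transfer] is meaningful. *)
Lemma transferS l x y :
  transfer l.+2 x y = transfer 1 x false * transfer l.+1 false y
                    + transfer 1 x true * transfer l.+1 true y.
Proof. by case: x; case: y; rewrite /transfer /= ?mul1n ?mul0n ?addn0 //; case: l. Qed.

Lemma transfer_antil l x y : transfer l true y <= transfer l x y.
Proof.
have := leq_fib l; have := leq_fib l.-1.
by case: x y l => -[] [] //=; rewrite /transfer //=.
Qed.

Lemma transfer_antir l x y : transfer l x true <= transfer l x y.
Proof. by rewrite transferC (transferC l x) transfer_antil. Qed.

Lemma pendant_false l : pendant l false = fib l.+2.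
Proof. by []. Qed.

Lemma pendant_true l : 0 < l -> pendant l true = fib l.+1.
Proof. by case: l. Qed.

Lemma pendant_anti l x : pendant l true <= pendant l x.
Proof. by rewrite leq_add ?transfer_antil. Qed.

(* The value of [sigma] on a cycle of length [c] with pendent paths of
   lengths [M] attached at one common vertex. *)
Definition lollipop c (M : seq nat) :=
  fib c.+1 * \prod_(l <- M) pendant l false + fib c.-1 * \prod_(l <- M) pendant l true.

(** The ranking of cycle lengths, with [c'] at least as good as [c]: even lengths beat odd ones,
    shorter even lengths beat longer ones, longer odd lengths beat shorter ones. *)
Definition better_cycle c' c :=
  if odd c' then odd c && (c <= c') else odd c || (c' <= c).

Lemma better_cycle_fib c' c : better_cycle c' c ->
  fib c.+1 * fib c'.+2 <= fib c'.+1 * fib c.+2 /\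
  fib c' * fib c.+1 <= fib c * fib c'.+1.
Proof.
rewrite /better_cycle => h.
have H a b : a <= b ->
  (odd a -> fib a.+1 * fib b <= fib a * fib b.+1) /\
  (~~ odd a -> fib a * fib b.+1 <= fib a.+1 * fib b).
  by move=> ab; have := fib_docagne (b - a) a; rewrite subnKC.
have [->|nc] := eqVneq c c'; first by split; rewrite // mulnC.
(* If [c < c'] the ranking forces [c] to be odd, and if [c' < c] it forces [c'] to be even. These
   are the parities for which d'Ocagne's sign is the wanted one. *)
case: (leqP c c') => cc'.
  have oc : odd c by move: h; case: ifP => _; lia.
  have [_ h2] := H c.+1 c'.+1 cc'; have [h1 _] := H c c' cc'.
  by have := h1 oc; have := h2; rewrite /= oc; lia.
have oc' : ~~ odd c' by move: h; case: ifP => // _; lia.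
have [h2 _] := H c'.+1 c.+1 (ltnW cc'); have [_ h1] := H c' c (ltnW cc').
by have := h1 oc'; have := h2 oc'; lia.
Qed.

(** Holds term by term, according to whether the common vertex is outside or inside the independent
    set. *)
Lemma lollipop_swap c c' M : 0 < c -> 0 < c' -> better_cycle c' c ->
  lollipop c (c' :: M) <= lollipop c' (c :: M).
Proof.
move=> c0 c'0 /better_cycle_fib [h1 h2].
rewrite /lollipop !big_cons !pendant_false !pendant_true // !mulnA.
apply: leq_add; rewrite leq_mul2r; apply/orP; right=> //.
case: c c0 h1 h2 => // c _ _; case: c' c'0 => // c' _ /=.
rewrite (fibSS c) (fibSS c'); lia.
Qed.

Lemma perm_lollipop c M M' : perm_eq M M' -> lollipop c M = lollipop c M'.
Proof. by move=> h; rewrite /lollipop !(perm_big _ h). Qed.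

(** The value of [sigma] for two vertices joined by two paths of lengths [c] and [d], with pendent
    paths of lengths [M] at one and [N] at the other. *)
Definition two_hubs c d (M N : seq nat) :=
  \sum_(x : bool) \sum_(y : bool) transfer c x y * transfer d x y *
     (\prod_(l <- M) pendant l x * \prod_(l <- N) pendant l y).

Lemma prod_pendant_anti M :
  \prod_(l <- M) pendant l true <= \prod_(l <- M) pendant l false.
Proof. by apply: leq_prod => l _; exact: pendant_anti. Qed.

Lemma two_hubsE c d M N : two_hubs c d M N =
  let X x := \prod_(l <- M) pendant l x in let Y y := \prod_(l <- N) pendant l y in
  fib c.+1 * fib d.+1 * (X false * Y false) + fib c * fib d * (X false * Y true)
  + fib c * fib d * (X true * Y false) + fib c.-1 * fib d.-1 * (X true * Y true).
Proof. by rewrite /two_hubs !big_bool /transfer /=; lia. Qed.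

Lemma two_hubs_sym c d M N : two_hubs c d M N = two_hubs d c M N.
Proof. by rewrite !two_hubsE /=; lia. Qed.

Lemma two_hubsC c d M N : two_hubs c d M N = two_hubs c d N M.
Proof. by rewrite !two_hubsE /=; lia. Qed.

(** With [X] and [Y] as in [two_hubsE], the difference is [fib d] times [fib c * (X false - X true)
    * (Y false - Y true) + fib c.-1 * X false * Y false - fib c.-2 * X true * Y true], which is
    nonnegative by monotonicity. *)
Lemma two_hubs_le_long c d M N : 2 < c -> 0 < d ->
  two_hubs c d M N <= lollipop c (d :: M ++ N).
Proof.
move=> c3 d0.
rewrite two_hubsE /lollipop !big_cons !big_cat /= pendant_false pendant_true //.
have := prod_pendant_anti M; have := prod_pendant_anti N.
move: (\prod_(l <- M) _) (\prod_(l <- M) _) (\prod_(l <- N) _) (\prod_(l <- N) _).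
move=> X1 X0 Y1 Y0 /subnKC <- /subnKC <-.
case: c c3 => [|[|[|c]]] // _; case: d d0 => // d _.
have := leq_fib c; rewrite /= !fibSS.
move: (fib d.+1) (fib d) (X0 - X1) (Y0 - Y1) (fib c.+1) (fib c).
by move=> f e p q g h /subnKC <-; nia.
Qed.

(** Neither joining path is long enough to become the cycle, so the pendent path of length [l] takes
    that place. The four choices of [c] and [d] are computed explicitly. *)
Lemma two_hubs_le_short_aux c d l M N : 0 < c <= 2 -> 0 < d <= 2 -> 2 < l ->
  two_hubs c d (l :: M) N <= lollipop l [:: c, d & M ++ N].
Proof.
move=> c12 d12 l3.
have Ec : c = 1 \/ c = 2 by lia.
have Ed : d = 1 \/ d = 2 by lia.
rewrite two_hubsE /lollipop !big_cons !big_cat /= !pendant_false !pendant_true //; try lia.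
have := prod_pendant_anti M; have := prod_pendant_anti N.
move: (\prod_(l <- M) _) (\prod_(l <- M) _) (\prod_(l <- N) _) (\prod_(l <- N) _).
move=> X1 X0 Y1 Y0 /subnKC <- /subnKC <-.
case: l l3 => [|[|[|l]]] // _.
have := leq_fib l; rewrite /= !fibSS.
move: (Y0 - X0) (X1 - Y1) (fib l.+1) (fib l) => p q g h /subnKC <-.
have [F0 [F1 [F2 [F3 F4]]]] : fib 0 = 0 /\ fib 1 = 1 /\ fib 2 = 1 /\ fib 3 = 2 /\ fib 4 = 3 by [].
by case: Ec => ->; case: Ed => ->; rewrite /= ?F0 ?F1 ?F2 ?F3 ?F4; nia.
Qed.

Lemma two_hubs_le_short c d M N : 0 < c <= 2 -> 0 < d <= 2 ->
  has (leq 3) (M ++ N) ->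
  exists2 l, 2 < l & exists2 M', perm_eq (l :: M') [:: c, d & M ++ N] &
    two_hubs c d M N <= lollipop l M'.
Proof.
move=> c12 d12 /hasP[l]; rewrite mem_cat => lMN l3; exists l => //.
wlog lM : M N lMN / l \in M.
  move=> IH; have /orP[lM|lN] := lMN; first exact: IH lM.
  have [|M' pM' leM'] := IH N M _ lN; first by rewrite lN.
  exists M'; last by rewrite two_hubsC.
  by rewrite (perm_trans pM') // !perm_cons perm_catC.
exists [:: c, d & rem l M ++ N].
  rewrite (perm_catCA [:: l] [:: c; d]) /= !perm_cons -cat_cons perm_cat2r.
  by rewrite perm_sym perm_to_rem.
have -> : two_hubs c d M N = two_hubs c d (l :: rem l M) N.
  by rewrite !two_hubsE /= !(perm_big _ (perm_to_rem lM)).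
exact: two_hubs_le_short_aux.
Qed.

(** * Sums over sets of vertices *)

Section SubsetSums.
Variable V : finType.
Implicit Types (A B D S : {set V}) (a b r v x y z : V) (P Q W : {set V} -> nat).

Lemma mem_setU1_neq a v S : a != v -> (a \in v |: S) = (a \in S).
Proof. by move=> av; rewrite !inE (negPf av). Qed.

Lemma sum_subsetU1 A v P : v \notin A ->
  \sum_(S : {set V} | S \subset v |: A) P S =
  \sum_(S : {set V} | S \subset A) (P S + P (v |: S)).
Proof.
move=> vA; rewrite (bigID (fun S => v \in S)) /= addnC big_split /=; congr (_ + _).
  apply: eq_bigl => S; rewrite -[in RHS](setU1K vA) subsetD1.
  by [].
rewrite (reindex_onto (fun S => v |: S) (fun S => S :\ v)) /=; last first.
  by move=> S /andP[_ vS]; rewrite setD1K.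
apply: eq_bigl => S; rewrite setU11 andbT; apply/andP/idP => [[SA /eqP <-]|SA].
  by rewrite -(setU1K vA) setSD.
split; first exact: setUS.
by rewrite setU1K //; apply: contra vA; exact: (subsetP SA).
Qed.

(** Makes [path (sparse S) x s] the statement that no two consecutive vertices of the walk both lie
    in [S]; read as a number, it is the indicator of independence along the walk. *)
Definition sparse S := [rel a b | ~~ ((a \in S) && (b \in S))].

Lemma sparse_pathU1 v S x s : v \notin x :: s ->
  path (sparse (v |: S)) x s = path (sparse S) x s.
Proof.
elim: s x => //= y s IH x; rewrite !inE !negb_or => /and3P[vx vy vs].
rewrite IH ?inE ?negb_or ?vy //.
by rewrite (eq_sym x) (negPf vx) (eq_sym y) (negPf vy).
Qed.

(** The transfer matrix method along the interior [m]. The ends may coincide, which covers closed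
    segments and cycles. *)
Lemma sum_path A Q x m y : uniq m -> x \notin m -> y \notin m ->
    {in m, forall v, v \notin A} -> {in m, forall v S, Q (v |: S) = Q S} ->
  \sum_(S : {set V} | S \subset [set z in m] :|: A) Q S * path (sparse S) x (rcons m y)
  = \sum_(S : {set V} | S \subset A) Q S * transfer (size m).+1 (x \in S) (y \in S).
Proof.
elim: m x A Q => [|v m IH] x A Q /=.
  move=> _ _ _ _ _.
  have -> : [set z in [::]] = set0 :> {set V} by apply/setP=> z; rewrite !inE.
  rewrite set0U; apply: eq_bigr => S _; rewrite andbT.
  by case: (x \in S); case: (y \in S).
move=> /andP[vm um]; rewrite !inE !negb_or => /andP[xv xm] /andP[yv ym] mA mQ.
have vA : v \notin A by apply: mA; rewrite inE eqxx.
have -> : [set z in v :: m] :|: A = [set z in m] :|: (v |: A).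
  by apply/setP=> z; rewrite !inE orbA (orbC (z == v)) -orbA.
(* The first edge goes into the factor [Q], which may now depend on [v], since [v] has joined the
   fixed vertices; [v] is summed out last. *)
have := IH v (v |: A) (fun S => Q S * sparse S x v); move=> IH1.
under eq_bigr => S _ do rewrite -mulnb mulnA.
rewrite {}IH1 //; first last.
- move=> z zm S; rewrite mQ ?in_cons ?zm ?orbT //=. rewrite !mem_setU1_neq //.
    by apply: contraNneq vm => ->.
  by apply: contraNneq xm => ->.
- move=> z zm; rewrite !inE negb_or mA ?inE ?zm ?orbT // andbT.
  by apply: contraNneq vm => <-.
rewrite sum_subsetU1 //; apply: eq_bigr => S SA.
have vS : v \notin S by apply: contra vA; exact: (subsetP SA).
rewrite mQ ?mem_head // (transferS (size m)) /= setU11 !mem_setU1_neq // (negPf vS).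
by rewrite mulnDr !mulnA; case: (x \in S); rewrite /= ?mul0n ?muln0 ?muln1 ?mul1n.
Qed.

(** The free end is first added to the fixed vertices, so that [sum_path] applies, and then summed
    out, which turns [transfer] into [pendant]. *)
Lemma sum_pendant_path A Q x m : m != [::] -> uniq m -> x \in A ->
    {in m, forall v, v \notin A} -> {in m, forall v S, Q (v |: S) = Q S} ->
  \sum_(S : {set V} | S \subset [set z in m] :|: A) Q S * path (sparse S) x m
  = \sum_(S : {set V} | S \subset A) Q S * pendant (size m) (x \in S).
Proof.
case/lastP: m => // m y _; rewrite rcons_uniq => /andP[ym um] xA mA mQ.
have mem_m z : z \in m -> z \in rcons m y by rewrite mem_rcons inE => ->; rewrite orbT.
have yA : y \notin A by apply: mA; rewrite mem_rcons inE eqxx.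
have xy : x != y by apply: contraNneq yA => <-.
have -> : [set z in rcons m y] :|: A = [set z in m] :|: (y |: A).
  by apply/setP=> z; rewrite !inE mem_rcons inE orbA (orbC (z == y)) -orbA.
rewrite sum_path //; first last.
- by move=> v vm; apply: mQ; exact: mem_m.
- move=> v vm; rewrite !inE negb_or mA ?mem_m // andbT.
  by apply: contraNneq ym => <-.
- by apply: contraL xA => /mem_m/mA.
rewrite sum_subsetU1 // size_rcons; apply: eq_bigr => S SA.
have yS : y \notin S by apply: contra yA; exact: (subsetP SA).
by rewrite mQ ?mem_rcons ?mem_head // setU11 mem_setU1_neq // (negPf yS) -mulnDr.
Qed.

Lemma sum_pendant_paths A Q x ms : all (fun m => m != [::]) ms ->
    uniq (flatten ms) -> x \in A ->
    {in flatten ms, forall v, v \notin A} ->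
    {in flatten ms, forall v S, Q (v |: S) = Q S} ->
  \sum_(S : {set V} | S \subset [set z in flatten ms] :|: A)
     Q S * \prod_(m <- ms) path (sparse S) x m
  = \sum_(S : {set V} | S \subset A) Q S * \prod_(m <- ms) pendant (size m) (x \in S).
Proof.
elim: ms Q => [|m ms IH] Q /=.
  move=> _ _ _ _ _.
  have -> : [set z in [::]] = set0 :> {set V} by apply/setP=> z; rewrite !inE.
  by rewrite set0U; apply: eq_bigr => S _; rewrite !big_nil.
rewrite cat_uniq => /andP[m0 ms0] /and3P[um /hasPn dm ums] xA msA msQ.
have in_m z : z \in m -> z \in m ++ flatten ms by rewrite mem_cat => ->.
have in_ms z : z \in flatten ms -> z \in m ++ flatten ms by rewrite mem_cat => ->; rewrite orbT.
have -> : [set z in m ++ flatten ms] :|: A = [set z in m] :|: ([set z in flatten ms] :|: A).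
  by rewrite setUA; congr (_ :|: _); apply/setP=> z; rewrite !inE mem_cat.
under eq_bigr => S _ do rewrite big_cons mulnCA mulnC.
rewrite (@sum_pendant_path _ (fun S => Q S * \prod_(m <- ms) path (sparse S) x m)) //; first last.
- move=> v vm S; rewrite msQ ?in_m //; congr (_ * _); rewrite !big_seq; apply: eq_bigr => m' m'ms.
  rewrite sparse_pathU1 // inE negb_or; apply/andP; split.
    by apply: contraTneq xA => <-; apply: msA; exact: in_m.
  by apply: contraL vm => vm'; apply: dm; apply/flattenP; exists m'.
- move=> v vm; rewrite !inE negb_or (msA _ (in_m _ vm)) andbT.
  by apply: contraL vm; exact: dm.
- by rewrite inE xA orbT.
rewrite (eq_bigr _ (fun S _ => mulnAC _ _ _)) IH //.
- by apply: eq_bigr => S _; rewrite big_cons mulnA.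
- by move=> v /in_ms; exact: msA.
move=> v vms S; rewrite msQ ?in_ms //; congr (_ * pendant _ _).
by rewrite mem_setU1_neq //; apply: contraTneq xA => ->; exact/msA/in_ms.
Qed.

Notation walk := (V * seq V * V)%type.

(** The walks are summed out one at a time: since interiors are disjoint, the indicators of the
    other walks belong to the factor that ignores the current interior. *)
Lemma sum_walks A Q (ws : seq walk) : uniq (flatten [seq w.1.2 | w <- ws]) ->
    {in ws, forall w, (w.1.1 \in A) && (w.2 \in A)} ->
    {in flatten [seq w.1.2 | w <- ws], forall v, v \notin A} ->
    {in flatten [seq w.1.2 | w <- ws], forall v S, Q (v |: S) = Q S} ->
  \sum_(S : {set V} | S \subset [set z in flatten [seq w.1.2 | w <- ws]] :|: A)
     Q S * \prod_(w <- ws) path (sparse S) w.1.1 (rcons w.1.2 w.2)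
  = \sum_(S : {set V} | S \subset A)
     Q S * \prod_(w <- ws) transfer (size w.1.2).+1 (w.1.1 \in S) (w.2 \in S).
Proof.
elim: ws Q => [|w ws IH] Q /=.
  move=> _ _ _ _.
  have -> : [set z in [::]] = set0 :> {set V} by apply/setP=> z; rewrite !inE.
  by rewrite set0U; apply: eq_bigr => S _; rewrite !big_nil.
move: IH; set m := w.1.2; set ms := flatten _ => IH.
rewrite cat_uniq => /and3P[um /hasPn dm ums] wsA msA msQ.
have in_m z : z \in m -> z \in m ++ ms by rewrite mem_cat => ->.
have in_ms z : z \in ms -> z \in m ++ ms by rewrite mem_cat => ->; rewrite orbT.
have /andP[xA yA] := wsA w (mem_head _ _).
have {}wsA w' : w' \in ws -> (w'.1.1 \in A) && (w'.2 \in A).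
  by move=> h; apply: wsA; rewrite inE h orbT.
have neqA v a : v \in m ++ ms -> a \in A -> a != v.
  by move=> vm aA; apply: contraTneq aA => ->; exact: msA.
have -> : [set z in m ++ ms] :|: A = [set z in m] :|: ([set z in ms] :|: A).
  by rewrite setUA; congr (_ :|: _); apply/setP=> z; rewrite !inE mem_cat.
under eq_bigr => S _ do rewrite big_cons mulnCA mulnC.
rewrite (@sum_path _
  (fun S => Q S * \prod_(w <- ws) path (sparse S) w.1.1 (rcons w.1.2 w.2))) //; first last.
- move=> v vm S; rewrite msQ ?in_m //; congr (_ * _); rewrite !big_seq.
  apply: eq_bigr => w' w'ws; have /andP[x'A y'A] := wsA _ w'ws.
  rewrite sparse_pathU1 // inE mem_rcons inE !negb_or !(eq_sym v) !neqA ?in_m //=.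
  apply: contraL vm => vm'; apply: dm; apply/flattenP; exists w'.1.2 => //.
  exact: map_f.
- move=> v vm; rewrite !inE negb_or (msA _ (in_m _ vm)) andbT.
  by apply: contraL vm; exact: dm.
- by apply: contraL yA => /in_m/msA.
- by apply: contraL xA => /in_m/msA.
rewrite (eq_bigr _ (fun S _ => mulnAC _ _ _)) IH //.
- by apply: eq_bigr => S _; rewrite big_cons mulnA.
- by move=> v /in_ms; exact: msA.
move=> v vms S; rewrite msQ ?in_ms // !mem_setU1_neq //; apply: neqA => //; exact: in_ms.
Qed.

(* For a product of edge weights, [W S * W (r, v, S) = W (r, S) * W (v, S)] says
   that no factor couples [r] with [v]. *)
Definition decoupled r v W := forall S,
  [/\ W S * W (r |: (v |: S)) = W (r |: S) * W (v |: S), W (r |: S) <= W S & W (v |: S) <= W S].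

(** If [a * d = b * c] with [b] and [c] at most [a], then [a * (a + d - b - c) = (a - b) * (a - c)]
    is nonnegative. *)
Lemma decoupled_supermod r v W S : decoupled r v W ->
  W (r |: S) + W (v |: S) <= W S + W (r |: (v |: S)).
Proof.
case/(_ S); move: (W _) (W _) (W _) (W _) => c b d a E ba ca.
have [a0|a0] := posnP a; first by lia.
rewrite -(leq_pmul2l a0) [a * (a + d)]mulnDr {}E.
have [p Ep] : exists p, a = b + p by exists (a - b); lia.
have [q Eq] : exists q, a = c + q by exists (a - c); lia.
have : p * (c + q) = p * (b + p) by congr (_ * _); lia.
by rewrite Ep; nia.
Qed.

Lemma decoupledM r v W W' : decoupled r v W -> decoupled r v W' ->
  decoupled r v (fun S => W S * W' S).
Proof.
move=> h h' S; have [E le1 le2] := h S; have [E' le1' le2'] := h' S.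
by split; [rewrite mulnACA E E' mulnACA | exact: leq_mul | exact: leq_mul].
Qed.

Lemma decoupled_prod r v (I : eqType) (s : seq I) (W : I -> {set V} -> nat) :
  {in s, forall i, decoupled r v (W i)} -> decoupled r v (fun S => \prod_(i <- s) W i S).
Proof.
elim: s => [|i s IH] h S; first by rewrite !big_nil.
rewrite !big_cons; apply: (@decoupledM r v (W i) (fun S => \prod_(i <- s) W i S)).
  by apply: h; rewrite mem_head.
by apply: IH => j js; apply: h; rewrite inE js orbT.
Qed.

(** A segment couples [r] with [v] only if these are its two ends. A loop, even at [r] or [v],
    depends on the state of a single vertex. *)
Lemma decoupled_transfer r v a b l : r != v ->
  (a == b) || ~~ ((a \in [:: r; v]) && (b \in [:: r; v])) ->
  decoupled r v (fun S => transfer l (a \in S) (b \in S)).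
Proof.
move=> rv ab S; rewrite !inE; split.
- have exc z : ~~ ((z == r) && (z == v)) by apply: contra rv => /andP[/eqP<- /eqP->].
  move: ab (exc a); case: eqVneq => [<- _|_ /=]; rewrite ?inE.
    by case: (a == r); case: (a == v) => //= _; rewrite mulnC.
  move: (exc b); case: (a == r); case: (a == v); case: (b == r); case: (b == v) => //= _ _ _;
    by rewrite mulnC.
- case: eqP => _; case: eqP => _ //=; rewrite ?transfer_antil ?transfer_antir //.
  by rewrite (leq_trans (transfer_antil _ (a \in S) _)) ?transfer_antir.
- case: eqP => _; case: eqP => _ //=; rewrite ?transfer_antil ?transfer_antir //.
  by rewrite (leq_trans (transfer_antil _ (a \in S) _)) ?transfer_antir.
Qed.

Lemma decoupled_pendant r v a l : r != v -> decoupled r v (fun S => pendant l (a \in S)).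
Proof.
move=> rv S; rewrite !inE; split; try by case: eqP => _ //=; rewrite pendant_anti.
have : ~~ ((a == r) && (a == v)) by apply: contra rv => /andP[/eqP<- /eqP->].
by case: (a == r); case: (a == v) => //= _; rewrite mulnC.
Qed.

(* Sliding everything but the segment [rv] from [v] to [r], which turns [rv]
   into a pendent path, increases the number of independent sets. *)
Lemma slide A r v l W : r \in A -> v \notin A -> decoupled r v W ->
  \sum_(S : {set V} | S \subset v |: A) transfer l (r \in S) (v \in S) * W S <=
  \sum_(S : {set V} | S \subset A)
     pendant l (r \in S) * W (if r \in S then v |: S else S).
Proof.
move=> rA vA Wrv; have rv : r != v by apply: contraNneq vA => <-.
rewrite sum_subsetU1 // -(setD1K rA).
have rAr : r \notin A :\ r by rewrite !inE eqxx.
rewrite !sum_subsetU1 //; apply: leq_sum => S SA.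
have rS : r \notin S by apply: contra rAr; exact: (subsetP SA).
have vS : v \notin S by apply: contra vA => /(subsetP SA); rewrite !inE => /andP[].
rewrite !inE !eqxx (negPf rS) (negPf vS) (negPf rv) (eq_sym v) (negPf rv) !orbT /=.
(* Over the four states of [r] and [v], the two sides differ by [transfer l false true] times the
   nonnegative quantity of [decoupled_supermod]. *)
have := decoupled_supermod S Wrv; rewrite setUCA /pendant (transferC l false true).
rewrite (setUCA [set v]).
move: (W _) (W _) (W _) (W _) => a d b c.
move: (transfer _ _ _) (transfer _ _ _) (transfer _ _ _) => p q s; nia.
Qed.

End SubsetSums.

(** * Contracting forests *)

Section Forests.
Variable V : finType.
Implicit Types (D B S : {set V}) (a b v x y z : V).

(* [(x, y, l)] is a segment of length [l] with ends [x] and [y]; in a forest, [x]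
   is the parent of [y]. *)
Notation seg := (V * V * nat)%type.
Implicit Types (e : seg) (t rest : seq seg) (us : seq ({set V} * nat)).

(** The order of the list is an order of construction: each segment hangs a new vertex on those
    already present, so [t] is a forest with the vertices of [D] as roots. *)
Fixpoint grow D t := if t is e :: t' then
  [&& e.1.1 \in D, e.1.2 \notin D & grow (e.1.2 |: D) t'] else true.

Definition children t : {set V} := [set z in [seq e.1.2 | e <- t]].

(** The effect on vertices of contracting every segment of [t]: each child is sent where its parent
    was sent by the earlier segments. *)
Definition root_of t : V -> V :=
  foldl (fun c e z => if z == e.1.2 then c e.1.1 else c z) id t.

Definition und e : {set V} * nat := ([set e.1.1; e.1.2], e.2).

Lemma mem_children e t : e \in t -> e.1.2 \in children t.
Proof. by move=> et; rewrite inE; apply/mapP; exists e. Qed.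

Lemma children_nil : children [::] = set0.
Proof. by apply/setP=> z; rewrite !inE. Qed.

Lemma children_cons e t : children (e :: t) = e.1.2 |: children t.
Proof. by apply/setP=> z; rewrite !inE. Qed.

Lemma children_cat t1 t2 : children (t1 ++ t2) = children t1 :|: children t2.
Proof. by apply/setP=> z; rewrite !inE map_cat mem_cat. Qed.

Lemma grow_cat D t1 t2 : grow D (t1 ++ t2) = grow D t1 && grow (children t1 :|: D) t2.
Proof.
elim: t1 D => [|e t1 IH] D /=; first by rewrite children_nil set0U.
by rewrite IH children_cons setUCA -!setUA -!andbA setUCA.
Qed.

Lemma grow_rcons D t e : grow D (rcons t e) =
  [&& grow D t, e.1.1 \in children t :|: D & e.1.2 \notin children t :|: D].
Proof. by rewrite -cats1 grow_cat /= andbT. Qed.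

Lemma grow_disjoint D t z : grow D t -> z \in D -> z \notin children t.
Proof.
elim: t D => [|e t IH] D /=; first by rewrite children_nil inE.
case/and3P=> _ eD g zD; rewrite children_cons in_setU1 negb_or.
by rewrite (IH _ g) ?in_setU1 ?zD ?orbT // andbT; apply: contraNneq eD => <-.
Qed.

Lemma grow_card D t : grow D t -> #|children t :|: D| = size t + #|D|.
Proof.
elim/last_ind: t => [|t e IH]; first by rewrite children_nil set0U.
rewrite grow_rcons size_rcons => /and3P[/IH{}IH _ e2].
rewrite -cats1 children_cat children_cons children_nil setU0 (setUC (children t)) -setUA.
by rewrite cardsU1 e2 IH.
Qed.

Lemma grow_sub D D' t : grow D t -> D \subset D' ->
  {in D', forall z, z \notin children t} -> grow D' t.
Proof.
elim: t D D' => //= e t IH D D' /and3P[e1 e2 g] sDD' dD'; apply/and3P; split.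
- exact: (subsetP sDD').
- by apply/negP=> /dD'; rewrite children_cons setU11.
apply: (IH _ _ g); first exact: setUS.
move=> z /setU1P[->|/dD']; last by rewrite children_cons in_setU1 negb_or => /andP[].
by apply: (grow_disjoint g); rewrite setU11.
Qed.

Lemma mem_parent D t e : grow D t -> e \in t -> e.1.1 \in children t :|: D.
Proof.
move=> g et; case/splitPr: et g => t1 t2; rewrite grow_cat children_cat /= => /andP[_ /and3P[]].
by rewrite !in_setU => /orP[->|->]; rewrite ?orbT.
Qed.

Lemma root_of_rcons t e z :
  root_of (rcons t e) z = if z == e.1.2 then root_of t e.1.1 else root_of t z.
Proof. by rewrite /root_of foldl_rcons. Qed.

Lemma root_of_notin t z : z \notin children t -> root_of t z = z.
Proof.
elim/last_ind: t => // t e IH; rewrite -cats1 children_cat !inE negb_or.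
by rewrite cats1 root_of_rcons => /andP[zt /negPf->]; rewrite IH ?inE.
Qed.

Lemma root_of_cat t1 t2 z : z \notin children t2 -> root_of (t1 ++ t2) z = root_of t1 z.
Proof.
elim/last_ind: t2 => [|t e IH]; first by rewrite cats0.
rewrite -cats1 children_cat !inE negb_or => /andP[zt /negPf ze].
by rewrite cats1 -rcons_cat root_of_rcons ze IH ?inE.
Qed.

Lemma root_of_in D t z : grow D t -> z \in children t :|: D -> root_of t z \in D.
Proof.
elim/last_ind: t z => [|t e IH] z; first by rewrite children_nil set0U.
rewrite grow_rcons => /and3P[g e1 e2]; rewrite root_of_rcons.
case: eqVneq => [_ _|ze zt]; first exact: IH.
by apply: IH => //; move: zt; rewrite -cats1 children_cat !inE (negPf ze) orbF.
Qed.

(** The weight of everything outside the forest: pendent paths [pl], recorded by attachment vertex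
    and length, and the segments [rest], never contracted. *)
Definition rest_value (pl : seq (V * nat)) rest S :=
  \prod_(p <- pl) pendant p.2 (p.1 \in S) *
  \prod_(e <- rest) transfer e.2 (e.1.1 \in S) (e.1.2 \in S).

Definition relabel (f : V -> V) pl rest S := rest_value
  [seq (f p.1, p.2) | p <- pl] [seq (f e.1.1, f e.1.2, e.2) | e <- rest] S.

(** Contracts the forest from its last segment backwards, one [slide] at a time; each contracted
    segment joins [pl]. A segment of [rest] that is not a loop has ends in different trees, so it
    never has the same two ends as the contracted segment. *)
Lemma collapse_pendants D t pl rest : grow D t ->
    {in rest, forall e, e.1.1 = e.1.2 \/ root_of t e.1.1 <> root_of t e.1.2} ->
  \sum_(S : {set V} | S \subset children t :|: D)
     (\prod_(e <- t) transfer e.2 (e.1.1 \in S) (e.1.2 \in S)) * rest_value pl rest S <=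
  \sum_(S : {set V} | S \subset D)
     (\prod_(e <- t) pendant e.2 (root_of t e.1.2 \in S)) * relabel (root_of t) pl rest S.
Proof.
elim/last_ind: t pl rest => [|t e IH] pl rest.
  move=> _ _; rewrite children_nil set0U.
  apply: leq_sum => S _; rewrite !big_nil !mul1n /relabel /root_of /=.
  rewrite (eq_map (g := id)) ?map_id; last by case.
  by rewrite (eq_map (g := id)) ?map_id; last by case=> -[].
rewrite grow_rcons => /and3P[g e1 e2] hrest.
have e12 : e.1.1 != e.1.2 by apply: contraNneq e2 => <-.
pose sub z := if z == e.1.2 then e.1.1 else z.
have root_sub z : root_of (rcons t e) z = root_of t (sub z).
  by rewrite root_of_rcons /sub; case: eqP.
have -> : children (rcons t e) :|: D = e.1.2 |: (children t :|: D).
  by rewrite -cats1 children_cat children_cons children_nil setU0 (setUC (children t)) setUA.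
have t_e2 e' : e' \in t -> e'.1.1 != e.1.2 /\ e'.1.2 != e.1.2.
  move=> e't; split; last first.
    by apply: contraNneq e2 => <-; rewrite in_setU mem_children.
  by apply: contraNneq e2 => <-; apply: mem_parent.
(* [W] is the weight of all but the last segment. It is decoupled at the ends of that segment
   because the child [e.1.2] is an end of no earlier segment of [t]. *)
pose W S := (\prod_(e <- t) transfer e.2 (e.1.1 \in S) (e.1.2 \in S)) * rest_value pl rest S.
have dW : decoupled e.1.1 e.1.2 W.
  apply: decoupledM; first apply: (@decoupled_prod _ _ _ _ _
    (fun e S => transfer e.2 (e.1.1 \in S) (e.1.2 \in S))).
    move=> e' /t_e2[n1 n2]; apply: decoupled_transfer => //.
    rewrite !inE (negPf n1) (negPf n2) !orbF; case: eqVneq => //= ne.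
    by apply: contraNN ne => /andP[/eqP-> /eqP->].
  apply: decoupledM.
    apply: (@decoupled_prod _ _ _ _ _ (fun p S => pendant p.2 (p.1 \in S))).
    by move=> p _; apply: decoupled_pendant.
  apply: (@decoupled_prod _ _ _ _ _ (fun e S => transfer e.2 (e.1.1 \in S) (e.1.2 \in S))).
  move=> e' e'r; apply: decoupled_transfer => //.
  have [->|ne] := hrest _ e'r; first by rewrite eqxx.
  apply/orP; right; apply/negP=> /andP[h1 h2]; apply: ne; rewrite !root_sub /sub.
  by move: h1 h2; rewrite !inE => /orP[]/eqP-> /orP[]/eqP->; rewrite ?eqxx ?(negPf e12).
have -> : \sum_(S : {set V} | S \subset e.1.2 |: (children t :|: D))
     (\prod_(e <- rcons t e) transfer e.2 (e.1.1 \in S) (e.1.2 \in S)) * rest_value pl rest S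
  = \sum_(S : {set V} | S \subset e.1.2 |: (children t :|: D))
     transfer e.2 (e.1.1 \in S) (e.1.2 \in S) * W S.
  by apply: eq_bigr => S _; rewrite -cats1 big_cat big_seq1 /= mulnAC mulnC.
apply: leq_trans (slide _ e1 e2 dW) _.
pose pl' := (e.1.1, e.2) :: [seq (sub p.1, p.2) | p <- pl].
pose rest' := [seq (sub e.1.1, sub e.1.2, e.2) | e <- rest].
apply: leq_trans (leq_trans (IH pl' rest' g _) _).
- apply: leq_sum => S SA.
  have e2S : e.1.2 \notin S by apply: contra e2; exact: (subsetP SA).
  have subS z : (z \in if e.1.1 \in S then e.1.2 |: S else S) = (sub z \in S).
    rewrite /sub; case: ifP => e1S; case: eqVneq => [->|ze]; rewrite ?inE ?eqxx ?e1S //.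
    + by rewrite (negPf ze).
    + by rewrite (negPf e2S).
  rewrite /W /rest_value /pl' /rest' big_cons /= !big_map /= -!mulnA mulnCA.
  rewrite leq_mul //.
    rewrite !big_seq; apply: leq_prod => e' /t_e2[n1 n2]; rewrite !subS /sub.
    by rewrite (negPf n1) (negPf n2).
  rewrite leq_mul2l; apply/orP; right; apply: leq_mul.
    by apply: leq_prod => p _; rewrite subS.
  by apply: leq_prod => e' _; rewrite !subS.
- by move=> e' /mapP[e0 /hrest h ->] /=; rewrite !root_sub in h; case: h => [->|h]; [left | right].
apply: leq_sum => S _.
rewrite /relabel /rest_value /pl' /rest' !big_map big_cons !big_map -cats1 big_cat big_seq1 /=.
rewrite cats1 root_sub /sub eqxx -!mulnA leq_mul //.
  rewrite !big_seq; apply: leq_prod => e' /t_e2[n1 n2].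
  by rewrite root_sub /sub (negPf n2).
rewrite leq_mul2l; apply/orP; right; apply: leq_mul.
  by apply: leq_prod => p _; rewrite root_sub.
by apply: leq_prod => e' _; rewrite !root_sub.
Qed.

Lemma grow_constant D h t : grow [set h] t ->
    {in t, forall e, (e.1.1 \in D) = (e.1.2 \in D)} ->
  {in children t :|: [set h], forall z, (z \in D) = (h \in D)}.
Proof.
elim/last_ind: t => [|t e IH]; first by rewrite children_nil set0U => _ _ z /set1P->.
rewrite grow_rcons => /and3P[g e1 e2] tD.
have {}IH : {in children t :|: [set h], forall z, (z \in D) = (h \in D)}.
  by apply: IH => // e' e't; apply: tD; rewrite mem_rcons inE e't orbT.
move=> z; rewrite -cats1 children_cat children_cons children_nil setU0 (setUC (children t)) -setUA.
case/setU1P=> [->|]; last exact: IH.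
by rewrite -tD ?mem_rcons ?mem_head // IH.
Qed.

(** Greedy growth from [h]: as long as the tree does not reach all of [B], a crossing segment is
    moved from the leftover list [r] to the tree. *)
Lemma spanning_tree B h us : h \in B ->
    (forall D, h \in D -> D \proper B ->
       exists2 u, u \in us & exists x y, [/\ u.1 = [set x; y], x \in D & y \in B :\: D]) ->
  exists t (r : seq ({set V} * nat)), [/\ grow [set h] t, children t :|: [set h] = B & perm_eq us (map und t ++ r)].
Proof.
move=> hB cross.
suff H n t (r : seq ({set V} * nat)) : #|B :\: (children t :|: [set h])| = n -> grow [set h] t ->
    children t :|: [set h] \subset B -> perm_eq us (map und t ++ r) ->
    exists t (r : seq ({set V} * nat)), [/\ grow [set h] t, children t :|: [set h] = B & perm_eq us (map und t ++ r)].
  by apply: (H _ [::] us erefl); rewrite //= children_nil set0U sub1set.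
elim: n t r => [|n IH] t r.
  move/eqP; rewrite cards_eq0 setD_eq0 => tB g Bt pus; exists t, r; split=> //.
  by apply/eqP; rewrite eqEsubset Bt.
set D := children t :|: _ => cn g DB pus.
have hD : h \in D by rewrite !inE eqxx orbT.
have [|u uus [x [y [u1 xD yD]]]] := cross D hD.
  by rewrite properE DB -setD_eq0 -cards_eq0 cn.
have {yD} [yB yD] : y \in B /\ y \notin D by move: yD; rewrite in_setD => /andP[].
(* A crossing segment has an end outside the current tree, so it is not already used there. *)
have ur : u \in r.
  move: uus; rewrite (perm_mem pus) mem_cat => /orP[/mapP[e et ue]|//].
  have : y \in u.1 by rewrite u1 !inE eqxx orbT.
  by rewrite ue !inE => /orP[]/eqP yE; case/negP: yD; rewrite yE;
     [exact: mem_parent | rewrite in_setU mem_children].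
have chE : children (rcons t (x, y, u.2)) :|: [set h] = y |: D.
  by rewrite -cats1 children_cat children_cons children_nil setU0 (setUC (children t)) -setUA.
apply: (IH (rcons t (x, y, u.2)) (rem u r)).
- apply: succn_inj; rewrite chE -cn (cardsD1 y (B :\: D)) in_setD yD yB add1n.
  by rewrite setDDl setUC.
- by rewrite grow_rcons g xD.
- by rewrite chE subUset sub1set yB.
rewrite map_rcons cat_rcons (perm_trans pus) // perm_cat2l.
have -> : und (x, y, u.2) = u by rewrite /und -u1; case: (u).
exact: perm_to_rem.
Qed.

(** Grows a new spanning tree from [x] using only the segments of [t]. Both trees span the same
    vertices, hence have the same size, and nothing is left over. *)
Lemma reroot_tree h x t : grow [set h] t -> x \in children t :|: [set h] ->
  exists t', [/\ grow [set x] t', children t' :|: [set x] = children t :|: [set h]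
    & perm_eq (map und t) (map und t')].
Proof.
move=> g xB; have [||t' [r [g' t'B p]]] := @spanning_tree (children t :|: [set h]) x (map und t).
- by [].
- move=> D xD DB.
  case: (boolP (all (fun e => (e.1.1 \in D) == (e.1.2 \in D)) t)) => [/allP tD|].
    have tD' : {in t, forall e, (e.1.1 \in D) = (e.1.2 \in D)} by move=> e /tD/eqP.
    case/negP: (proper_subn DB); apply/subsetP=> z zB.
    by rewrite (grow_constant g tD' zB) -(grow_constant g tD' xB).
  case/allPn=> e et eD; exists (und e); first by apply: map_f.
  have e2B : e.1.2 \in children t :|: [set h] by rewrite in_setU mem_children.
  have e1B := mem_parent g et.
  move: eD; case: (boolP (e.1.1 \in D)) => e1D; case: (boolP (e.1.2 \in D)) => e2D // _.
    by exists e.1.1, e.1.2; rewrite in_setD e2D.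
  by exists e.1.2, e.1.1; rewrite /= setUC in_setD e1D.
exists t'; split=> //; suff -> : map und t' = map und t' ++ r by [].
have := perm_size p; rewrite size_cat !size_map.
have := grow_card g; have := grow_card g'; rewrite t'B => -> /eqP; rewrite !cards1 eqn_add2r => /eqP <-.
by move/eqP; rewrite -[X in X == _]addn0 eqn_add2l eq_sym size_eq0 => /eqP->; rewrite cats0.
Qed.

(** The form of [transfer] that depends only on the set of ends. A loop has a singleton as its set
    of ends and needs no separate case. *)
Definition seg_weight (u : {set V} * nat) S :=
  if u.1 \subset S then fib u.2.-1 else if [disjoint u.1 & S] then fib u.2.+1 else fib u.2.

Lemma seg_weight_und e S : seg_weight (und e) S = transfer e.2 (e.1.1 \in S) (e.1.2 \in S).
Proof.
rewrite /seg_weight /transfer disjoints_subset /= !subUset !sub1set !inE.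
by case: (_ \in S); case: (_ \in S).
Qed.

Lemma sum_subset0 P : \sum_(S : {set V} | S \subset set0) P S = P set0.
Proof. by rewrite (eq_bigl (fun S => S == set0)) ?big_pred1_eq // => S; rewrite subset0. Qed.

(** The loop at the root survives the contraction of the whole tree and becomes the cycle. *)
Lemma tree_loop_le x t c : grow [set x] t -> all (leq 1) [seq e.2 | e <- t] ->
  \sum_(S : {set V} | S \subset children t :|: [set x])
     \prod_(u <- rcons (map und t) ([set x; x], c)) seg_weight u S
  <= lollipop c [seq e.2 | e <- t].
Proof.
move=> g pos.
have := @collapse_pendants [set x] t [::] [:: (x, x, c)] g.
move=> /(_ _)/leq_trans H; apply: leq_trans (H _ _ _) => {H}.
- apply: leq_sum => S _; rewrite /rest_value big_nil big_seq1 mul1n -cats1 big_cat big_map big_seq1.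
  rewrite leq_mul //; last by rewrite (seg_weight_und (x, x, c)).
  by apply: leq_prod => e _; rewrite seg_weight_und.
- by move=> e; rewrite inE => /eqP->; left.
rewrite -(setU0 [set x]) sum_subsetU1 ?inE // sum_subset0 setU0.
have root_x z : z \in children t -> root_of t z = x.
  by move=> zt; apply/set1P; apply: (root_of_in g); rewrite in_setU zt.
rewrite /relabel /rest_value /= !big_nil !big_seq1 /= !mul1n root_of_notin; last first.
  by apply: (grow_disjoint g); rewrite inE.
rewrite !inE eqxx /lollipop !big_map mulnC leq_add //.
  by rewrite leq_mul // !big_seq; apply: leq_prod => e et; rewrite root_x ?mem_children // inE.
rewrite mulnC leq_mul // !big_seq; apply: leq_prod => e et.
by rewrite root_x ?mem_children // inE eqxx.
Qed.

(** Omitting the segment of length [d] above [y] leaves a forest with roots [x] and [y]. Its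
    contraction leaves that segment and the extra one as the two joining paths, and pendent paths
    sorted by root. *)
Lemma tree_chord_le x y t c : x != y -> y \in children t -> grow [set x] t ->
  exists d M N, perm_eq (d :: M ++ N) [seq e.2 | e <- t] /\
    \sum_(S : {set V} | S \subset children t :|: [set x])
     \prod_(u <- rcons (map und t) ([set x; y], c)) seg_weight u S <= two_hubs c d M N.
Proof.
move=> xy yt g.
have [[[p y'] d] et /= ey] : exists2 e, e \in t & y = e.1.2 by move: yt; rewrite inE => /mapP.
subst y'; case/splitPr: et g yt => t1 t2.
rewrite grow_cat /= => /and3P[g1 pt1 /andP[yt1 g2]] _.
pose D := [set x; y].
have gD1 : grow D t1.
  apply: (grow_sub g1); first by rewrite sub1set !inE eqxx.
  move=> z /set2P[]->; last by move: yt1; rewrite in_setU negb_or => /andP[].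
  by apply: (grow_disjoint g1); rewrite inE.
have g12 : grow D (t1 ++ t2).
  rewrite grow_cat gD1 /=; move: g2; rewrite setUCA; congr grow.
  by apply/setP=> z; rewrite !inE; do !case: eqP.
set rt := root_of (t1 ++ t2).
have rtD z : z \in D -> rt z = z.
  by move=> zD; apply: root_of_notin; apply: (grow_disjoint g12).
have rt_in e : e \in t1 ++ t2 -> rt e.1.2 \in D.
  by move=> et; apply: (root_of_in g12); rewrite in_setU mem_children.
(* The parent [p] of [y] is present before [y] is added, so it lies in the part grown from [x]
   alone. *)
have rtp : rt p = x.
  rewrite /rt root_of_cat; last first.
    apply: (grow_disjoint g2); rewrite in_setU1; by apply/orP; right.
  by apply/set1P; exact: root_of_in g1 pt1.
have xD : x \in D by rewrite !inE eqxx.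
have yD : y \in D by rewrite !inE eqxx orbT.
pose Lx := [seq e.2 | e <- t1 ++ t2 & rt e.1.2 == x].
pose Ly := [seq e.2 | e <- t1 ++ t2 & rt e.1.2 != x].
exists d, Lx, Ly; split.
  rewrite map_cat /= perm_sym -[d :: [seq e.2 | e <- t2]]cat1s perm_catCA /= perm_cons.
  rewrite -!map_cat perm_map // perm_sym.
  by rewrite (perm_filterC (fun e : seg => rt e.1.2 == x)).
have := @collapse_pendants D (t1 ++ t2) [::] [:: (x, y, c); (p, y, d)] g12.
have -> : children (t1 ++ (p, y, d) :: t2) :|: [set x] = children (t1 ++ t2) :|: D.
  rewrite !children_cat children_cons /D /=.
  by rewrite -!setUA [[set y] :|: _]setUCA [[set y] :|: _]setUC.
move=> /(_ _)/leq_trans H; apply: leq_trans (H _ _ _) => {H}.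
- apply: leq_sum => S _; rewrite /rest_value big_nil !big_cons big_nil mul1n -cats1.
  rewrite map_cat /= !big_cat /= big_cons !big_seq1 !big_map.
  rewrite (seg_weight_und (x, y, c)) (seg_weight_und (p, y, d)) /=.
  rewrite !(eq_bigr _ (fun e _ => seg_weight_und e S)).
  by move: (transfer c _ _) (transfer d _ _) (\prod_(i <- t1) _) (\prod_(i <- t2) _) => *; lia.
- by move=> e; rewrite !inE => /orP[]/eqP->; right => /=; rewrite -/rt ?rtp !rtD //; apply/eqP.
have prodE S : \prod_(e <- t1 ++ t2) pendant e.2 (rt e.1.2 \in S) =
   \prod_(l <- Lx) pendant l (x \in S) * \prod_(l <- Ly) pendant l (y \in S).
  rewrite (bigID (fun e => rt e.1.2 == x)) /= /Lx /Ly !big_map !big_filter.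
  congr (_ * _); first by apply: eq_bigr => e /eqP->.
  rewrite big_seq_cond [RHS]big_seq_cond; apply: eq_bigr => e /andP[/rt_in/set2P[]-> //].
  by rewrite eqxx.
rewrite /D -(setU0 [set y]) sum_subsetU1 ?inE ?orbF //.
rewrite sum_subsetU1 ?inE // sum_subset0 !setU0 -/rt !prodE.
rewrite /relabel /rest_value /= !big_nil !big_cons !big_nil /= !mul1n !muln1 -/rt rtp !rtD //.
rewrite !inE !eqxx (negPf xy) (eq_sym y) (negPf xy) two_hubsE /transfer /=.
move: (\prod_(l <- Lx) _) (\prod_(l <- Lx) _) (\prod_(l <- Ly) _) (\prod_(l <- Ly) _) => X0 X1 Y0 Y1.
move: (fib c.+1) (fib c) (fib c.-1) (fib d.+1) (fib d) (fib d.-1) => *; lia.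
Qed.

End Forests.

(** * Bounds for a spanning tree with one extra segment *)

Section SegmentBound.
Variable V : finType.
Implicit Types (D B S : {set V}) (x y : V) (us : seq ({set V} * nat)).

(** With as many segments as vertices, exactly one lies outside a spanning tree, which is then
    rerooted at an end of it. If that segment is a loop it has to be the cycle itself, so loops are
    required to be long. *)
Lemma segments_le B h us : h \in B -> size us = #|B| ->
    (forall D, h \in D -> D \proper B ->
       exists2 u, u \in us & exists x y, [/\ u.1 = [set x; y], x \in D & y \in B :\: D]) ->
    {in us, forall u, exists x y, [/\ u.1 = [set x; y], x \in B, y \in B & x = y -> 2 < u.2]} ->
    all (leq 1) [seq u.2 | u <- us] -> has (leq 3) [seq u.2 | u <- us] ->
  exists l M, [/\ 2 < l, perm_eq (l :: M) [seq u.2 | u <- us] &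
    \sum_(S : {set V} | S \subset B) \prod_(u <- us) seg_weight u S <= lollipop l M].
Proof.
move=> hB sz_us cross ends pos long.
have [t0 [r [g0 t0B pr]]] := spanning_tree hB cross.
have sz_r : size r = 1.
  apply/eqP; rewrite -(eqn_add2l (size t0)).
  have := grow_card g0; rewrite t0B cards1 -sz_us (perm_size pr) size_cat size_map => ->.
  by [].
case: r sz_r pr => [|u []] // _ pr.
have uus : u \in us by rewrite (perm_mem pr) mem_cat inE eqxx orbT.
have [x [y [u1 xB yB xy_long]]] := ends u uus.
have [|t [g tB pt]] := @reroot_tree _ h x t0 g0; first by rewrite t0B.
have {pr pt} pus : perm_eq us (rcons (map (@und V) t) ([set x; y], u.2)).
  rewrite (perm_trans pr) // cats1 -u1 -surjective_pairing.
  by rewrite -!cats1 perm_cat2r.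
have lens : perm_eq [seq u.2 | u <- us] (u.2 :: [seq e.2 | e <- t]).
  rewrite (perm_trans (perm_map _ pus)) // map_rcons perm_rcons perm_cons -map_comp.
  by rewrite perm_refl.
rewrite -t0B -tB; under eq_bigr => S _ do rewrite (perm_big _ pus).
have tpos : all (leq 1) [seq e.2 | e <- t].
  by move: pos; rewrite (perm_all _ lens) => /andP[].
have [xy|xy] := eqVneq x y.
  subst y; exists u.2, [seq e.2 | e <- t]; split; first exact: xy_long.
    by rewrite perm_sym.
  exact: tree_loop_le.
have yt : y \in children t.
  by move: yB; rewrite -t0B -tB in_setU inE [y == x]eq_sym (negPf xy) orbF.
have [d [M [N [pdMN le_dMN]]]] := tree_chord_le u.2 xy yt g.
have p_cd : perm_eq [:: u.2, d & M ++ N] [seq u.2 | u <- us].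
  by rewrite perm_sym (perm_trans lens) // perm_cons perm_sym.
move: pos long; rewrite -(perm_all _ p_cd) -(perm_has _ p_cd) /= => /and3P[c0 d0 _] long.
have [c3|c3] := ltnP 2 u.2.
  exists u.2, (d :: M ++ N); split=> //.
  by apply: leq_trans le_dMN _; exact: two_hubs_le_long.
have [d3|d3] := ltnP 2 d.
  exists d, (u.2 :: M ++ N); split=> //.
    by rewrite (perm_trans _ p_cd) // (perm_catCA [:: d] [:: u.2]).
  by apply: leq_trans le_dMN _; rewrite two_hubs_sym; exact: two_hubs_le_long.
(* Both joining paths have length at most 2, so the entry of length at least 3 is a pendent path. *)
have [|||l l3 [M' pM' leM']] := @two_hubs_le_short u.2 d M N; rewrite ?c0 ?d0 //.
  by move: long; rewrite ltnNge c3 ltnNge d3.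
exists l, M'; split=> //; first exact: perm_trans pM' p_cd.
exact: leq_trans le_dMN leM'.
Qed.

End SegmentBound.

(** * Spanning trees and cycles *)

Section CycleSpace.
Variable G : sgraph.
Local Notation V := (gV G).
Local Notation adj := (@gadj G).
Implicit Types (x y z v : V) (F : {set {set V}}).

Lemma adj_neq x y : adj x y -> x != y.
Proof. by apply: contraTneq => ->; rewrite (@girr G). Qed.

Lemma mem_edges x y : ([set x; y] \in edges G) = adj x y.
Proof.
rewrite inE; apply/existsP/idP => [[a /existsP[b /andP[ab /eqP E]]]|xy].
  have /andP[xab yab] : (x \in [set a; b]) && (y \in [set a; b]) by rewrite -E !inE !eqxx orbT.
  have /andP[axy bxy] : (a \in [set x; y]) && (b \in [set x; y]) by rewrite E !inE !eqxx orbT.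
  move: xab yab axy bxy; rewrite !inE => /orP[]/eqP-> /orP[]/eqP-> //.
    by move=> _ /orP[]/eqP bE; rewrite bE (@girr G) in ab.
    by rewrite (@gsym G).
  by move=> /orP[]/eqP aE; rewrite aE (@girr G) in ab.
by exists x; apply/existsP; exists y; rewrite xy eqxx.
Qed.

Lemma edgesP (e : {set V}) : reflect (exists x y, adj x y /\ e = [set x; y]) (e \in edges G).
Proof.
apply: (iffP idP) => [|[x [y [xy ->]]]]; last by rewrite mem_edges.
by rewrite inE => /existsP[x /existsP[y /andP[xy /eqP->]]]; exists x, y.
Qed.

Lemma closed_trail_is_cycle (c : seq V) : uniq c -> 2 < size c -> cycle adj c ->
  is_cycle [set [set z; next c z] | z in c].
Proof.
move=> uc sc cc; set F := imset _ _.
(* This is where at least three vertices are needed: it makes the two edges at each vertex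
   distinct. *)
have next_neq x : x \in c -> next c x != prev c x.
  move=> xc; apply/eqP=> E; have {E} : next c (next c x) = x by rewrite E next_prev.
  case: (rot_to xc) => i s Es; have us : uniq (x :: s) by rewrite -Es rot_uniq.
  rewrite -!(next_rot i uc) Es; have : 2 < size (x :: s) by rewrite -Es size_rot.
  case: s us {Es} => [|y [|z s]] //= us _.
  rewrite eqxx; case: us; rewrite !inE !negb_or => /andP[/and3P[xy xz xs] /andP[/andP[yz ys] _]].
  by rewrite eqxx (eq_sym y) (negPf xy) => E; rewrite E eqxx in xz.
have degF x : [set e in F | x \in e] =
    if x \in c then [set [set x; next c x]; [set prev c x; x]] else set0.
  apply/setP=> e; rewrite inE; case: ifP => xc.
    apply/andP/set2P => [[/imsetP[z zc ->]]|].
      rewrite !inE => /orP[/eqP->|/eqP->]; first by left.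
      by right; rewrite prev_next.
    case=> ->; rewrite !inE eqxx ?orbT; split=> //; first by apply/imsetP; exists x.
    by apply/imsetP; exists (prev c x); rewrite ?mem_prev // next_prev.
  rewrite inE; apply/negP=> /andP[/imsetP[z zc ->]]; rewrite !inE => /orP[]/eqP xz.
    by rewrite xz zc in xc.
  by rewrite xz mem_next zc in xc.
have cardF x : #|[set e in F | x \in e]| = if x \in c then 2 else 0.
  rewrite degF; case: ifP => xc; last by rewrite cards0.
  rewrite cards2; case: eqP => // /setP/(_ (next c x)).
  rewrite !inE eqxx orbT (negPf (next_neq x xc)) /= => /esym/eqP nx.
  by have := next_cycle cc xc; rewrite nx (@girr G).
apply/and4P; split.
- by apply/subsetP=> _ /imsetP[z zc ->]; rewrite mem_edges; exact: next_cycle.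
- case: c sc @F {uc cc next_neq degF cardF} => // x c _ F.
  by apply/set0Pn; exists [set x; next (x :: c) x]; apply/imsetP; exists x; rewrite ?mem_head.
- by apply/forallP=> v; rewrite cardF; case: ifP.
apply/forallP=> x; apply/forallP=> y; rewrite !cardF.
case: ifP => // xc; case: ifP => //= yc.
apply: (@connect_cycle _ _ c) => //; apply: (sub_in_cycle (P := mem c)) (cycle_next uc) => //.
  by move=> a b ac _ /eqP <-; apply/imsetP; exists a.
Qed.

Definition tree_edges (t : seq (V * V * nat)) : {set {set V}} :=
  [set f in [seq (und e).1 | e <- t]].

Lemma tree_edgesP t f : reflect (exists2 e, e \in t & f = (und e).1) (f \in tree_edges t).
Proof. by rewrite inE; apply: mapP. Qed.

Lemma tree_connect h t : grow [set h] t ->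
  {in children t :|: [set h] &, forall x y,
     connect [rel a b | [set a; b] \in tree_edges t] x y}.
Proof.
move=> g; have csym : connect_sym [rel a b | [set a; b] \in tree_edges t].
  by apply: sym_connect_sym => a b /=; rewrite setUC.
suff H z : z \in children t :|: [set h] -> connect [rel a b | [set a; b] \in tree_edges t] h z.
  move=> x y /H hx /H hy; apply: connect_trans hy; by rewrite csym.
set r := [rel a b | _] in csym *; move=> zt.
have rC : {in t, forall e, (e.1.1 \in [set z | connect r h z]) = (e.1.2 \in [set z | connect r h z])}.
  move=> e et; rewrite !in_set ![connect r h _]csym; apply: same_connect => //.
  by apply: connect1; apply/tree_edgesP; exists e.
by have := grow_constant g rC zt; rewrite !in_set connect0.
Qed.

(** A simple tree path from [a] to [b], closed by the edge between them. It has more than one edge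
    because this edge is not in the tree. *)
Lemma fundamental_cycle h t a b : grow [set h] t -> children t :|: [set h] = setT ->
    tree_edges t \subset edges G -> adj a b -> [set a; b] \notin tree_edges t ->
  exists F, [/\ is_cycle F, [set a; b] \in F & F \subset [set a; b] |: tree_edges t].
Proof.
move=> g tT tE ab abt.
have /connectP[p0 p0P bE] : connect [rel a b | [set a; b] \in tree_edges t] a b.
  by apply: (tree_connect g); rewrite tT inE.
case: (shortenP p0P) bE => p pP up _ bE {p0 p0P}.
have sp : 2 < size (a :: p).
  case: p pP bE {up} => [|y [|z p]] //= yP E.
    by rewrite E (@girr G) in ab.
  by case/negP: abt; rewrite E; case/andP: yP.
have cp : cycle [rel x y | [set x; y] \in [set a; b] |: tree_edges t] (a :: p).
  rewrite /= rcons_path -bE /= [[set b; a]]setUC setU11 andbT.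
  by apply: sub_path pP => x y /= xy; rewrite in_setU xy orbT.
exists [set [set z; next (a :: p) z] | z in a :: p]; split.
- apply: closed_trail_is_cycle => //; apply: sub_cycle cp => x y /= /setU1P[E|xy].
    by rewrite -mem_edges E mem_edges.
  by rewrite -mem_edges (subsetP tE).
- apply/imsetP; exists b; first by rewrite bE mem_last.
  suff -> : next (a :: p) b = a by rewrite setUC.
  (* The index of the last vertex runs past the end of [p], so [nth] returns its default [a], which
     is the cyclic successor. *)
  by rewrite bE next_nth mem_last index_last // nth_default.
by apply/subsetP=> _ /imsetP[z zp ->]; have := next_cycle cp zp.
Qed.

(** Segments are removed from the end of [t] until one lies in [F]; its child was new when added, so
    it is on no other edge of [F]. *)
Lemma forest_acyclic D t F : grow D t -> F \subset tree_edges t -> F != set0 ->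
  exists v, #|[set e in F | v \in e]| = 1.
Proof.
elim/last_ind: t => [|t e IH].
  move=> _ /subsetP F0 /set0Pn[e /F0/tree_edgesP[]] //.
rewrite grow_rcons => /and3P[g e1 e2] Ft Fn0.
have eF f : f \in F -> f = [set e.1.1; e.1.2] \/ f \in tree_edges t.
  move=> /(subsetP Ft)/tree_edgesP[e' ]; rewrite mem_rcons inE => /orP[/eqP->|e't] ->; first by left.
  by right; apply/tree_edgesP; exists e'.
case: (boolP ([set e.1.1; e.1.2] \in F)) => [eeF|eeF]; last first.
  apply: IH => //; apply/subsetP=> f fF; case: (eF f fF) => // E.
  by rewrite -E fF in eeF.
exists e.1.2; apply/eqP/cards1P; exists [set e.1.1; e.1.2]; apply/setP=> f; rewrite !inE.
apply/andP/eqP => [[/eF[//|/tree_edgesP[e' e't ->]]]|->]; last by rewrite eeF !inE eqxx orbT.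
rewrite !inE => /orP[]/eqP E; case/negP: e2; rewrite E.
  exact: mem_parent.
by rewrite in_setU mem_children.
Qed.

Lemma connected_crossing (D : {set V}) h : connected G -> h \in D -> D \proper setT ->
  exists x y, [/\ adj x y, x \in D & y \notin D].
Proof.
move=> cG hD DT; case: (boolP [forall x, forall y, (x \in D) ==> adj x y ==> (y \in D)]).
  move=> /forallP clD; case/negP: (proper_subn DT); apply/subsetP=> z _.
  have /connectP[p pP ->] := forallP (forallP cG h) z.
  elim: p h hD pP => //= y p IH x xD /andP[xy yp]; apply: (IH y) => //.
  by have /forallP/(_ y) := clD x; rewrite xD xy.
case/forallPn=> x /forallPn[y]; rewrite !negb_imply => /and3P[xD xy yD].
by exists x, y.
Qed.

(** Each edge outside a spanning tree closes a cycle through itself and tree edges. Uniqueness of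
    the cycle allows at most one such edge, and [forest_acyclic] excludes that there is none. *)
Lemma unicyclic_card_edges : unicyclic G -> #|edges G| = #|V|.
Proof.
case/andP=> cG /cards1P[F0 F0P].
have F0c : is_cycle F0 by have := set11 F0; rewrite -F0P inE.
have isF0 F : is_cycle F -> F = F0.
  by move=> Fc; apply/set1P; rewrite -F0P inE.
have [h _] : exists h : V, true.
  by case/and4P: F0c => /subsetP F0E /set0Pn[e /F0E/edgesP[x _]]; exists x.
(* The dummy length 1 turns edges into input for [spanning_tree]. *)
pose us : seq ({set V} * nat) := [seq (e, 1) | e <- enum (edges G)].
have us_uniq : uniq us by rewrite map_inj_uniq ?enum_uniq // => e f [].
have [||t [r [g tT pus]]] := @spanning_tree _ setT h us.
- by rewrite inE.
- move=> D hD DT; have [x [y [xy xD yD]]] := connected_crossing cG hD DT.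
  exists ([set x; y], 1); last by exists x, y; rewrite !inE yD.
  by apply/mapP; exists [set x; y]; rewrite ?mem_enum ?mem_edges.
have us_edges u : (u \in us) -> u.1 \in edges G /\ u.2 = 1.
  by case/mapP=> e; rewrite mem_enum => eE ->.
have tE : tree_edges t \subset edges G.
  apply/subsetP=> _ /tree_edgesP[e et ->]; apply: (us_edges _ _).1.
  by rewrite (perm_mem pus) mem_cat map_f.
have := us_uniq; rewrite (perm_uniq pus) cat_uniq => /and3P[_ /hasPn tr ur].
have r_out u : u \in r -> u.1 \notin tree_edges t.
  move=> urr; apply/negP=> /tree_edgesP[e et ue]; case/negP: (tr u urr).
  have [_ u2] : u.1 \in edges G /\ u.2 = 1 by apply: us_edges; rewrite (perm_mem pus) mem_cat urr orbT.
  have [_ e2] : (und e).1 \in edges G /\ (und e).2 = 1.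
    by apply: us_edges; rewrite (perm_mem pus) mem_cat map_f.
  have -> : u = und e by rewrite (surjective_pairing u) (surjective_pairing (und e)) ue u2 e2.
  exact: map_f.
have r_cyc u : u \in r -> u.1 \in F0 /\ F0 \subset u.1 |: tree_edges t.
  move=> urr; have [/edgesP[a [b [ab uE]]] _] : u.1 \in edges G /\ u.2 = 1.
    by apply: us_edges; rewrite (perm_mem pus) mem_cat urr orbT.
  have [|F [/isF0-> abF Fsub]] := @fundamental_cycle h t a b g tT tE ab.
    by rewrite -uE r_out.
  by rewrite uE.
have szus : #|edges G| = size t + size r.
  by rewrite cardE -(size_map (fun e => (e, 1))) (perm_size pus) size_cat size_map.
have cV : #|V| = size t + 1 by rewrite -cardsT -tT grow_card // cards1.
rewrite szus cV; congr (_ + _).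
case: r szus pus ur tr r_out r_cyc => [|u [|u' r]] //= _ pus.
  move=> _ _ _ _; have F0t : F0 \subset tree_edges t.
    case/and4P: F0c => /subsetP F0E _ _ _; apply/subsetP=> f /F0E fE.
    have : (f, 1) \in us by apply/mapP; exists f; rewrite ?mem_enum.
    by rewrite (perm_mem pus) cats0 => /mapP[e et [fe _]]; apply/tree_edgesP; exists e.
  case/and4P: F0c => _ F0n /forallP F02 _.
  by have [v v1] := forest_acyclic g F0t F0n; have := F02 v; rewrite v1.
rewrite inE negb_or => /andP[/andP[uu' _] _] _ r_out r_cyc.
have [u'F _] : u'.1 \in F0 /\ F0 \subset u'.1 |: tree_edges t by apply: r_cyc; rewrite !inE eqxx orbT.
have [_ /subsetP/(_ _ u'F)] : u.1 \in F0 /\ F0 \subset u.1 |: tree_edges t by apply: r_cyc; rewrite !inE eqxx.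
rewrite in_setU1 (negPf (r_out u' _)) ?inE ?eqxx ?orbT // orbF => /eqP E.
case/eqP: uu'; rewrite (surjective_pairing u) (surjective_pairing u') E; congr pair.
have [_ ->] : u.1 \in edges G /\ u.2 = 1 by apply: us_edges; rewrite (perm_mem pus) mem_cat !inE eqxx !orbT.
by have [_ ->] : u'.1 \in edges G /\ u'.2 = 1 by apply: us_edges; rewrite (perm_mem pus) mem_cat !inE eqxx !orbT.
Qed.

End CycleSpace.

(** * Segments *)

Lemma prod_nat_of_bool (T : Type) (b : T -> bool) (s : seq T) :
  \prod_(i <- s) b i = all b s.
Proof. by elim: s => [|i s IH]; rewrite ?big_nil // big_cons IH mulnb. Qed.

Lemma uniq_flatten_map (T U I : eqType) (f : T -> seq U) (g : T -> I) (s : seq T) :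
    uniq (map g s) -> {in s, forall w, uniq (f w)} ->
    {in s &, forall w w' z, z \in f w -> z \in f w' -> g w = g w'} ->
  uniq (flatten (map f s)).
Proof.
elim: s => //= w s IH /andP[gw ug] uf disj; rewrite cat_uniq uf ?mem_head // IH //.
- rewrite andbT; apply/hasPn=> z /flattenP[_ /mapP[w' w's ->] zw'].
  apply: contra gw => zw; rewrite (disj w w' _ _ z) ?mem_head ?in_cons ?w's ?orbT //.
  exact: map_f.
- by move=> w' w's; apply: uf; rewrite in_cons w's orbT.
by move=> w1 w2 h1 h2; apply: disj; rewrite in_cons ?h1 ?h2 orbT.
Qed.

Lemma finite_choice (T U : eqType) (P : T -> U -> Prop) (f : U -> T) (s : seq T) :
    (forall i w, P i w -> f w = i) ->
    {in s, forall i, exists w, P i w} ->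
  exists2 ws, map f ws = s & {in ws, forall w, P (f w) w}.
Proof.
move=> fP; elim: s => [|i s IH] h; first by exists [::].
have [|ws ws_s wsP] := IH; first by move=> j js; apply: h; rewrite in_cons js orbT.
have [w Pw] := h i (mem_head _ _); exists (w :: ws); first by rewrite /= ws_s (fP i).
by move=> w'; rewrite in_cons => /orP[/eqP->|/wsP//]; rewrite (fP i).
Qed.

#[local] Arguments walk_edges : simpl never.

Section Segments.
Variable G : sgraph.
Local Notation V := (gV G).
Local Notation adj := (@gadj G).
Local Notation wedges := (@walk_edges G).
Implicit Types (x y z v : V) (m s : seq V) (e f : {set V}).

Lemma walk_edges_cons x y s : wedges (x :: y :: s) = [set x; y] :: wedges (y :: s).
Proof. by []. Qed.

Lemma size_walk_edges x s : size (wedges (x :: s)) = size s.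
Proof. by elim: s x => // y s IH x; rewrite walk_edges_cons /= IH. Qed.

Lemma walk_edges_rcons x s z :
  wedges (rcons (x :: s) z) = rcons (wedges (x :: s)) [set last x s; z].
Proof. by elim: s x => //= y s IH x; rewrite walk_edges_cons -rcons_cons IH. Qed.

Lemma walk_edges_rev s : wedges (rev s) = rev (wedges s).
Proof.
elim: s => // x [|y s] // IH; rewrite rev_cons.
case E: (rev (y :: s)) => [|a r]; first by have := congr1 size E; rewrite size_rev.
rewrite walk_edges_rcons -E IH walk_edges_cons rev_cons.
have -> : last a r = y by have := congr1 (last x) E; rewrite rev_cons last_rcons /= => ->.
by rewrite setUC.
Qed.

Lemma walk_edges_sub x s e : path adj x s -> e \in wedges (x :: s) -> e \in edges G.
Proof.
elim: s x => //= y s IH x /andP[xy p]; rewrite walk_edges_cons in_cons => /orP[/eqP->|].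
  by rewrite mem_edges.
exact: IH.
Qed.

Lemma mem_walk_edges x s e v : e \in wedges (x :: s) -> v \in e -> v \in x :: s.
Proof.
elim: s x => //= y s IH x; rewrite walk_edges_cons in_cons => /orP[/eqP->|].
  by rewrite !inE => /orP[]->; rewrite ?orbT.
by move=> h /(IH y h) vs; rewrite in_cons vs orbT.
Qed.

Lemma count_walk_edges x s v : path adj x s ->
  count (fun e => v \in e) (wedges (x :: s)) = count_mem v (belast x s) + count_mem v s.
Proof.
elim: s x => // y s IH x /andP[xy p]; rewrite walk_edges_cons [LHS]/= IH // /= !inE.
have := adj_neq xy; rewrite (eq_sym v x) (eq_sym v y).
by case: (eqVneq x v) => [->|_]; case: (eqVneq y v) => [->|_] //=; rewrite ?eqxx // ?addnA //; lia.
Qed.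

Lemma deg_edges v : deg v = #|[set e in edges G | v \in e]|.
Proof.
rewrite /deg -(card_in_imset (f := fun w => [set v; w])); last first.
  move=> w w'; rewrite !inE => /adj_neq vw _ /setP/(_ w).
  by rewrite !inE eqxx orbT eq_sym (negPf vw) => /esym/eqP.
apply: eq_card => e; rewrite [RHS]inE; apply/imsetP/andP => [[w]|[/edgesP[a [b [ab ->]]]]].
  by rewrite inE => vw ->; rewrite mem_edges !inE eqxx.
rewrite !inE => /orP[]/eqP->; first by exists b; rewrite ?inE.
by exists a; rewrite ?inE 1?setUC // (@gsym G).
Qed.

Lemma walk_covers x s v e : path adj x s -> uniq (wedges (x :: s)) ->
  deg v <= count (fun e => v \in e) (wedges (x :: s)) ->
  e \in edges G -> v \in e -> e \in wedges (x :: s).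
Proof.
move=> p u dv eG ve.
have : [set f | f \in filter (fun e => v \in e) (wedges (x :: s))] == [set f in edges G | v \in f].
  rewrite eqEcard -deg_edges cardsE (card_uniqP _) ?filter_uniq // size_filter dv andbT.
  by apply/subsetP=> f; rewrite in_set mem_filter in_set => /andP[-> /(walk_edges_sub p)->].
by move/eqP/setP/(_ e); rewrite in_set mem_filter in_set ve eG => /andP[].
Qed.

Lemma walk_uncovered x s v : path adj x s -> uniq (wedges (x :: s)) ->
  count (fun e => v \in e) (wedges (x :: s)) < deg v ->
  exists2 z, adj v z & [set v; z] \notin wedges (x :: s).
Proof.
move=> p u dv.
have : ~~ ([set f in edges G | v \in f]
          \subset [set f | f \in filter (fun e => v \in e) (wedges (x :: s))]).
  apply: contraL dv => /subset_leq_card; rewrite -deg_edges cardsE.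
  by rewrite (card_uniqP _) ?filter_uniq // size_filter -leqNgt.
case/subsetPn=> f; rewrite in_set => /andP[fG vf]; rewrite in_set mem_filter vf /=.
case/edgesP: fG vf => a [b [ab ->]]; rewrite !inE => /orP[]/eqP-> h; first by exists b.
by exists a; rewrite 1?(@gsym G) // setUC.
Qed.

Lemma deg_leq_count x s v : path adj x s -> uniq (wedges (x :: s)) ->
  count (fun e => v \in e) (wedges (x :: s)) <= deg v.
Proof.
move=> p u; rewrite deg_edges -size_filter -(card_uniqP (filter_uniq _ u)).
apply: subset_leq_card; apply/subsetP=> f; rewrite mem_filter in_set.
by move=> /andP[-> /(walk_edges_sub p)->].
Qed.

(** A segment without the degree condition on its ends: the invariant while a walk is extended to a
    full segment. *)
Definition trail x m y := [&& path adj x (rcons m y), uniq (wedges (x :: rcons m y)),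
  uniq m & all (fun v => deg v == 2) m].

Lemma internal_trail x m y : internal (x :: rcons m y) = m.
Proof. by rewrite /internal /= size_rcons subn1 /= drop0 -cats1 take_size_cat. Qed.

Lemma is_segmentE x m y : is_segment (x :: rcons m y) =
  [&& trail x m y, deg x != 2 & deg y != 2].
Proof.
by rewrite /is_segment internal_trail /= last_rcons size_rcons /trail -!andbA.
Qed.

Lemma count_trail x m y v : path adj x (rcons m y) ->
  count (fun e => v \in e) (wedges (x :: rcons m y)) =
  (x == v) + (y == v) + 2 * count_mem v m.
Proof.
move=> p; rewrite count_walk_edges // belast_rcons /= -cats1 count_cat /=; lia.
Qed.

Lemma trail_rev x m y : trail x m y -> trail y (rev m) x.
Proof.
have E : y :: rcons (rev m) x = rev (x :: rcons m y) by rewrite rev_cons rev_rcons.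
rewrite /trail E walk_edges_rev !rev_uniq all_rev => /and4P[p -> -> ->]; rewrite !andbT.
have := rev_path adj x (rcons m y); rewrite last_rcons belast_rcons rev_cons => ->.
by rewrite (eq_path (e' := adj)) // => a b; rewrite (@gsym G).
Qed.

(** If [x] and [y] differ, only one of the two edges at [y] is used and the other extends the trail.
    If they coincide, the closed trail exhausts all edges at its vertices, so by connectedness all
    degrees would be 2. *)
Lemma trail_extend x m y : connected G -> (exists v : V, deg v != 2) ->
  trail x m y -> deg y = 2 -> exists z, trail x (rcons m y) z.
Proof.
move=> cG [v0 v0d] /and4P[p ue um dm] dy.
have cnt v := count_trail v p.
have ym : y \notin m.
  have := deg_leq_count y p ue; rewrite cnt dy eqxx -has_pred1 has_count; lia.
have [xy|xy] := eqVneq x y.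
  subst y; pose D := [set z in x :: m].
  have Dd v : v \in D -> deg v = 2.
    by rewrite !inE => /orP[/eqP->//|/(allP dm)/eqP].
  have [||a [b [ab aD bD]]] := @connected_crossing G D x cG.
  - by rewrite !inE eqxx.
  - by rewrite properT; apply: contraNneq v0d => DT; rewrite Dd // DT inE.
  have abw : [set a; b] \in wedges (x :: rcons m x).
    apply: (walk_covers p ue (v := a)); rewrite ?mem_edges ?inE ?eqxx // cnt Dd //.
    move: aD; rewrite in_set in_cons => /orP[/eqP->|am]; first by rewrite eqxx.
    by have : 0 < count_mem a m by [rewrite -has_count has_pred1]; lia.
  case/negP: bD; have := mem_walk_edges abw (v := b).
  by rewrite !inE eqxx orbT mem_rcons inE => /(_ isT); rewrite orbA orbb.
have [|z yz zw] := walk_uncovered (v := y) p ue.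
  by rewrite cnt dy eqxx (negPf xy) (count_memPn ym).
exists z; rewrite /trail rcons_path p last_rcons yz -rcons_cons walk_edges_rcons last_rcons.
by rewrite !rcons_uniq zw ue ym um all_rcons dy eqxx.
Qed.

(** Extends at [y], and at [x] after reversal, while the end has degree 2. This stops because the
    interior of a trail is shorter than the number of edges. *)
Lemma trail_in_segment x m y : connected G -> (exists v : V, deg v != 2) -> trail x m y ->
  exists x' m' y', is_segment (x' :: rcons m' y') /\
    {subset wedges (x :: rcons m y) <= wedges (x' :: rcons m' y')}.
Proof.
move=> cG hB; have [n] := ubnP (#|edges G| - size m).
elim: n x m y => // n IH x m y lt_n t.
have m_lt x' m' y' : trail x' m' y' -> size m' < #|edges G|.
  case/and4P=> p u _ _; rewrite -(size_rcons m' y') -(size_walk_edges x') -(card_uniqP u).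
  by apply: subset_leq_card; apply/subsetP=> e; exact: walk_edges_sub.
have lt_m := m_lt _ _ _ t.
have step x1 m1 y1 : trail x1 m1 y1 -> size m1 = size m -> deg y1 = 2 ->
  exists x' m' y', is_segment (x' :: rcons m' y') /\
    {subset wedges (x1 :: rcons m1 y1) <= wedges (x' :: rcons m' y')}.
  move=> t1 sz dy; have [z tz] := trail_extend cG hB t1 dy.
  have [|x' [m' [y' [sg sub]]]] := IH _ _ _ _ tz; first by rewrite size_rcons sz; lia.
  exists x', m', y'; split=> // e ew; apply: sub.
  by rewrite -rcons_cons walk_edges_rcons mem_rcons in_cons ew orbT.
have [dy|dy] := eqVneq (deg y) 2; first exact: (step _ _ _ t erefl dy).
have [dx|dx] := eqVneq (deg x) 2; last by exists x, m, y; split=> //; rewrite is_segmentE t dx.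
have [|x' [m' [y' [sg sub]]]] := step _ _ _ (trail_rev t) _ dx; first by rewrite size_rev.
exists x', m', y'; split=> // e ew; apply: sub.
have -> : y :: rcons (rev m) x = rev (x :: rcons m y) by rewrite rev_cons rev_rcons.
by rewrite walk_edges_rev mem_rev.
Qed.

Lemma segment_closed x m y e f v : is_segment (x :: rcons m y) ->
  e \in wedges (x :: rcons m y) -> v \in e -> deg v = 2 -> f \in edges G -> v \in f ->
  f \in wedges (x :: rcons m y).
Proof.
rewrite is_segmentE => /and3P[/and4P[p u _ _] dx dy] ew ve dv fG vf.
apply: (walk_covers p u (v := v)) => //; rewrite dv.
have : 0 < count (fun e => v \in e) (wedges (x :: rcons m y)).
  by rewrite -has_count; apply/hasP; exists e.
have xv : x != v by apply: contraNneq dx => ->; rewrite dv.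
have yv : y != v by apply: contraNneq dy => ->; rewrite dv.
by rewrite count_trail // (negPf xv) (negPf yv); lia.
Qed.

(* Consecutive edges of a segment share a vertex of degree 2. *)
Lemma segment_spread x m y (C : pred {set V}) : path adj x (rcons m y) ->
    all (fun v => deg v == 2) m ->
    (forall e f v, C e -> v \in e -> deg v = 2 -> f \in edges G -> v \in f -> C f) ->
  has C (wedges (x :: rcons m y)) -> all C (wedges (x :: rcons m y)).
Proof.
move=> + + cl; elim: m x => [|a m IH] x; first by move=> _ _; rewrite /walk_edges /= orbF andbT.
rewrite rcons_cons => /andP[xa p] /andP[/eqP da dm]; rewrite walk_edges_cons.
have eG : [set x; a] \in edges G by rewrite mem_edges.
have ax : a \in [set x; a] by rewrite !inE eqxx orbT.
have [b [s Es]] : exists b s, rcons m y = b :: s.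
  by case: (m) => [|b s]; [exists y, [::] | exists b, (rcons s y)].
have ab : a \in [set a; b] by rewrite !inE eqxx.
have fG : [set a; b] \in edges G by rewrite mem_edges; move: p; rewrite Es => /andP[].
move=> /orP[Ce|].
  rewrite /= Ce; apply: IH => //; rewrite Es walk_edges_cons /=.
  by rewrite (cl _ _ a Ce).
move=> /(IH a p dm) allC; rewrite /= allC andbT.
move: allC; rewrite Es walk_edges_cons /= => /andP[Cf _].
exact: (cl _ _ a Cf).
Qed.

(** A segment contains all edges at each of its vertices of degree 2, so a common edge propagates
    along either segment into the other. *)
Lemma segment_eq x m y x' m' y' e :
    is_segment (x :: rcons m y) -> is_segment (x' :: rcons m' y') ->
    e \in wedges (x :: rcons m y) -> e \in wedges (x' :: rcons m' y') ->
  [set:: wedges (x :: rcons m y)] = [set:: wedges (x' :: rcons m' y')].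
Proof.
have H x1 m1 y1 x2 m2 y2 : is_segment (x1 :: rcons m1 y1) -> is_segment (x2 :: rcons m2 y2) ->
    e \in wedges (x1 :: rcons m1 y1) -> e \in wedges (x2 :: rcons m2 y2) ->
  {subset wedges (x1 :: rcons m1 y1) <= wedges (x2 :: rcons m2 y2)}.
  move=> s1 s2 e1 e2; have := s1; rewrite is_segmentE => /and3P[/and4P[p _ _ dm] _ _].
  apply/allP; apply: (segment_spread (C := fun e => e \in wedges (x2 :: rcons m2 y2)) p dm).
    by move=> f f' v; apply: segment_closed.
  by apply/hasP; exists e.
move=> s s' es es'; apply/setP=> f; rewrite !inE.
by apply/idP/idP; apply: H.
Qed.

End Segments.

Lemma uniq_flatten_inj (T U : eqType) (f : T -> seq U) (s : seq T) w w' z :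
    uniq (flatten (map f s)) -> w \in s -> w' \in s -> z \in f w -> z \in f w' -> w = w'.
Proof.
elim: s => //= a s IH; rewrite cat_uniq => /and3P[_ /hasPn dis us].
have out v : v \in s -> z \in f v -> z \notin f a.
  by move=> vs zv; apply: dis; apply/flatten_mapP; exists v.
rewrite !in_cons => /orP[/eqP->|ws] /orP[/eqP->|w's] zw zw' //.
- by have := out _ w's zw'; rewrite zw.
- by have := out _ ws zw; rewrite zw'.
exact: IH.
Qed.

(** * The number of independent sets as a sum over the ends of segments *)

Section SigmaSegments.
Variable G : sgraph.
Local Notation V := (gV G).
Local Notation adj := (@gadj G).
Implicit Types (S : {set V}).

Definition independent S := [forall x in S, forall y in S, ~~ adj x y].

Lemma independentP S :
  reflect (forall x y, x \in S -> y \in S -> ~~ adj x y) (independent S).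
Proof.
apply: (iffP forall_inP) => [h x y xS yS|h x xS].
  by have /forall_inP := h x xS; apply.
by apply/forall_inP=> y; exact: h.
Qed.

Lemma sigma_sum : sigma G = \sum_(S : {set V}) independent S.
Proof. by rewrite /sigma -sum1dep_card big_mkcond; apply: eq_bigr => S _; rewrite /independent; case: ifP. Qed.

Lemma sparse_walk_edges S x (s : seq V) :
  path (sparse S) x s = all (fun e : {set V} => ~~ (e \subset S)) (walk_edges (x :: s)).
Proof.
elim: s x => // y s IH x; rewrite walk_edges_cons /= IH.
by rewrite subUset !sub1set.
Qed.

Definition walk_of (w : V * seq V * V) := w.1.1 :: rcons w.1.2 w.2.

(** Leaves are included: these are the possible ends of segments, not only the vertices of degree at
    least 3. *)
Definition branching : {set V} := [set v | deg v != 2].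

(** One walk is chosen per segment. The walks partition the edges, and their interiors partition the
    vertices of degree 2. *)
Lemma segment_system L : unicyclic G -> has_segseq G L -> L != [::] ->
  exists ws : seq (V * seq V * V),
  [/\ {in ws, forall w, is_segment (walk_of w)},
      perm_eq [seq (size w.1.2).+1 | w <- ws] L,
      forall e, e \in edges G -> exists2 w, w \in ws & e \in walk_edges (walk_of w),
      uniq (flatten [seq w.1.2 | w <- ws]) &
      [set z in flatten [seq w.1.2 | w <- ws]] = ~: branching /\ size ws = #|branching|].
Proof.
move=> uG [_ [Fs [uFs FsP pFs]]] L0; have [cG _] := andP uG.
have walkP s : is_segment s -> exists w, walk_of w = s.
  case: s => // x s; case/lastP: s => [|m y _]; first by case/andP.
  by exists (x, m, y).
have [|ws wsFs wsP] := @finite_choice _ _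
  (fun F w => is_segment (walk_of w) /\ [set:: walk_edges (walk_of w)] = F)
  (fun w => [set:: walk_edges (walk_of w)]) Fs (fun F w => @proj2 _ _).
  move=> F /FsP[s [sg sF]]; have [w ws] := walkP s sg.
  by exists w; rewrite ws.
have ws_seg w : w \in ws -> is_segment (walk_of w) by case/wsP.
have parts w : w \in ws -> [/\ path adj w.1.1 (rcons w.1.2 w.2),
    uniq (walk_edges (walk_of w)), uniq w.1.2, all (fun v => deg v == 2) w.1.2
    & deg w.1.1 != 2 /\ deg w.2 != 2].
  by move/ws_seg; rewrite /walk_of is_segmentE => /and3P[/and4P[p ue um dm] dx dy].
(* A nonempty [L] provides a segment, whose ends do not have degree 2; this excludes a bare
   cycle. *)
have B0 : exists v : V, deg v != 2.
  case: ws wsFs parts {wsP ws_seg} => [FsE|w ws _ parts].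
    by move: pFs; rewrite -FsE /= perm_sym => /perm_nilP LE; rewrite LE in L0.
  by exists w.1.1; have [_ _ _ _ []] := parts w (mem_head _ _).
have cover e : e \in edges G -> exists2 w, w \in ws & e \in walk_edges (walk_of w).
  case/edgesP=> x [y [xy ->]].
  have [|x' [m' [y' [sg sub]]]] := @trail_in_segment G x [::] y cG B0.
    by rewrite /trail /= xy.
  have : [set:: walk_edges (x' :: rcons m' y')] \in Fs by apply/FsP; exists (x' :: rcons m' y').
  rewrite -wsFs => /mapP[w wws Ew]; exists w => //.
  have : [set x; y] \in [set:: walk_edges (x' :: rcons m' y')].
    by rewrite in_set; apply: sub; rewrite mem_head.
  by rewrite Ew in_set.
have we_count w v : w \in ws -> deg v = 2 -> (v \in w.1.2) = has (fun e : {set V} => v \in e) (walk_edges (walk_of w)).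
  move=> /parts[p ue um dm [dx dy]] dv.
  rewrite has_count count_trail // -has_pred1 has_count.
  have xv : w.1.1 != v by apply: contraNneq dx => ->; rewrite dv.
  have yv : w.2 != v by apply: contraNneq dy => ->; rewrite dv.
  by rewrite (negPf xv) (negPf yv) muln_gt0.
have same w w' e : w \in ws -> w' \in ws -> e \in walk_edges (walk_of w) ->
    e \in walk_edges (walk_of w') -> [set:: walk_edges (walk_of w)] = [set:: walk_edges (walk_of w')].
  by move=> /ws_seg sw /ws_seg sw'; exact: segment_eq.
have uws : uniq [seq [set:: walk_edges (walk_of w)] | w <- ws] by rewrite wsFs.
have um : uniq (flatten [seq w.1.2 | w <- ws]).
  apply: (uniq_flatten_map uws) => [w /parts[]//|w w' wws w'ws v vw vw'].
  have dv : deg v = 2 by have [_ _ _ /allP/(_ v vw)/eqP] := parts w wws.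
  move: (vw); rewrite (we_count w) // => /hasP[e ew ve].
  have [p _ _ _ _] := parts w wws.
  move: (vw'); rewrite (we_count w') // => /hasP[e' ew' ve'].
  apply: (same w w' e) => //; apply: (segment_closed (ws_seg w' w'ws) ew' ve' dv) => //.
  exact: walk_edges_sub ew.
have ue : uniq (flatten [seq walk_edges (walk_of w) | w <- ws]).
  by apply: (uniq_flatten_map uws) => [w /parts[]//|w w' wws w'ws e]; exact: same.
have mB : [set z in flatten [seq w.1.2 | w <- ws]] = ~: branching.
  apply/setP=> v; rewrite in_set in_setC in_set negbK; apply/flatten_mapP/eqP => [[w wws vw]|dv].
    by have [_ _ _ /allP/(_ v vw)/eqP] := parts w wws.
  have : [set e in edges G | v \in e] != set0 by rewrite -card_gt0 -deg_edges dv.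
  case/set0Pn=> e; rewrite in_set => /andP[/cover[w wws ew] ve]; exists w => //.
  by rewrite we_count //; apply/hasP; exists e.
exists ws; split=> //.
  apply: perm_trans pFs; rewrite -wsFs -map_comp.
  suff -> : [seq (size w.1.2).+1 | w <- ws] = [seq #|[set:: walk_edges (walk_of w)]| | w <- ws].
    exact: perm_refl.
  apply/eq_in_map=> w /parts[_ uw _ _ _].
  by rewrite cardsE (card_uniqP uw) size_walk_edges size_rcons.
(* A segment has one more edge than internal vertices. As there are as many edges as vertices, there
   are as many segments as vertices in [branching]. *)
split=> //; have cE : #|edges G| = size (flatten [seq walk_edges (walk_of w) | w <- ws]).
  rewrite -(card_uniqP ue); apply: eq_card => e; apply/idP/flatten_mapP => [/cover[w wws ew]|[w wws ew]].
    by exists w.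
  by have [p _ _ _ _] := parts w wws; exact: walk_edges_sub ew.
have szE : size (flatten [seq walk_edges (walk_of w) | w <- ws])
  = size (flatten [seq w.1.2 | w <- ws]) + size ws.
  elim: (ws) => //= w s IH; rewrite !size_cat IH size_walk_edges size_rcons; lia.
have : #|~: branching| = size (flatten [seq w.1.2 | w <- ws]).
  by rewrite -mB cardsE (card_uniqP um).
have := cardsC branching; rewrite -(unicyclic_card_edges uG) cE szE => + E.
by rewrite -E addnC => /eqP; rewrite eqn_add2l => /eqP.
Qed.

Lemma independent_cover S (ws : seq (V * seq V * V)) :
    {in ws, forall w, path adj w.1.1 (rcons w.1.2 w.2)} ->
    (forall e, e \in edges G -> exists2 w, w \in ws & e \in walk_edges (walk_of w)) ->
  independent S = all (fun w => path (sparse S) w.1.1 (rcons w.1.2 w.2)) ws.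
Proof.
move=> paths cover; apply/independentP/allP => [ind w wws|h x y xS yS].
  rewrite sparse_walk_edges; apply/allP=> e ew.
  have /edgesP[x [y [xy ->]]] := walk_edges_sub (paths w wws) ew.
  by apply: contraL xy; rewrite subUset !sub1set => /andP[]; exact: ind.
rewrite -mem_edges; apply/negP=> /cover[w /h]; rewrite sparse_walk_edges => /allP hw /hw.
by rewrite subUset !sub1set xS yS.
Qed.

(** Summing out all interiors leaves the weighted sum bounded in [segments_le]; the rest checks its
    hypotheses for the graph of segments. *)
Lemma sigma_le_lollipop L : unicyclic G -> has_segseq G L -> has (leq 3) L ->
  exists l M, [/\ 2 < l, perm_eq (l :: M) L & sigma G <= lollipop l M].
Proof.
move=> uG LG long; have [cG _] := andP uG.
have [|ws [wsP lens cover um [mB szB]]] := segment_system uG LG; first by case: (L) long.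
have parts w : w \in ws -> [/\ path adj w.1.1 (rcons w.1.2 w.2),
    uniq (walk_edges (walk_of w)), w.1.1 \in branching & w.2 \in branching].
  move=> /wsP; rewrite /walk_of is_segmentE => /and3P[/and4P[p ue _ _] dx dy].
  by rewrite !in_set.
pose us := [seq ([set w.1.1; w.2], (size w.1.2).+1) | w <- ws].
have usL : perm_eq [seq u.2 | u <- us] L by rewrite -map_comp.
have -> : sigma G = \sum_(S : {set V} | S \subset branching) \prod_(u <- us) seg_weight u S.
  rewrite sigma_sum; transitivity (\sum_(S : {set V} | S \subset
      [set z in flatten [seq w.1.2 | w <- ws]] :|: branching)
      1 * \prod_(w <- ws) path (sparse S) w.1.1 (rcons w.1.2 w.2)).
    rewrite mB setUC setUCr; apply: eq_big => [S|S _]; first by rewrite subsetT.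
    rewrite mul1n prod_nat_of_bool (@independent_cover S ws) //.
    by move=> w /parts[].
  rewrite (sum_walks (Q := fun=> 1)) //.
  - apply: eq_bigr => S _; rewrite mul1n big_map; apply: eq_bigr => w _.
    by rewrite -(seg_weight_und (w.1.1, w.2, (size w.1.2).+1)).
  - by move=> w /parts[_ _ -> ->].
  by move=> v vf; rewrite -in_setC -mB in_set.
have [w0 w0ws] : exists w, w \in ws.
  case: (ws) lens => [|w ws' _]; last by exists w; rewrite mem_head.
  by rewrite perm_sym => /perm_nilP LE; rewrite LE in long.
have [_ _ hB _] := parts w0 w0ws.
have [|||||l [M [l3 lM le]]] := @segments_le V branching w0.1.1 us hB.
- by rewrite size_map.
(* [C] adds to [D] the interiors of the segments that start in it. If no segment crossed [D], no
   edge would leave [C], against the connectedness of [G]. *)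
- move=> D hD DB; pose C := D :|: [set z | has (fun w => (w.1.1 \in D) && (z \in w.1.2)) ws].
  have [/hasP[w wws]|noc] := boolP (has (fun w => (w.1.1 \in D) != (w.2 \in D)) ws).
    have [_ _ xB yB] := parts w wws.
    case: (boolP (w.1.1 \in D)) => xD; case: (boolP (w.2 \in D)) => yD // _.
      exists ([set w.1.1; w.2], (size w.1.2).+1); last by exists w.1.1, w.2; rewrite in_setD yD.
      by apply/mapP; exists w.
    exists ([set w.1.1; w.2], (size w.1.2).+1).
      by apply/mapP; exists w.
    by exists w.2, w.1.1; rewrite /= setUC in_setD xD.
  have ends w : w \in ws -> (w.2 \in D) = (w.1.1 \in D).
    by move=> wws; apply/esym/eqP/negPn; move/hasPn: noc; apply.
  have mid w v : w \in ws -> v \in w.1.2 -> v \notin branching.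
    by move=> wws vw; rewrite -in_setC -mB in_set; apply/flatten_mapP; exists w.
  have [/subsetP DsubB [b bB bD]] := properP DB.
  have [||a [c [ac aC]]] := @connected_crossing G C w0.1.1 cG.
  - by rewrite in_setU hD.
  - rewrite properT; apply: contraNneq bD => CT.
    have : b \in C by rewrite CT in_setT.
    rewrite in_setU in_set => /orP[//|/hasP[w wws /andP[_ /(mid w b wws)]]].
    by rewrite bB.
  have [|w wws acw] := cover [set a; c]; first by rewrite mem_edges.
  have aw : a \in walk_of w by apply: (mem_walk_edges acw); rewrite set21.
  have cw : c \in walk_of w by apply: (mem_walk_edges acw); rewrite set22.
  have xD : w.1.1 \in D.
    have [_ _ xB yB] := parts w wws.
    move: aC aw; rewrite in_setU in_set /walk_of in_cons mem_rcons in_cons => /orP[aD|].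
      case/or3P=> [/eqP<- //|/eqP aE|/(mid w a wws)]; first by rewrite -ends // -aE.
      by rewrite DsubB.
    case/hasP=> w' w'ws /andP[x'D aw']; have aB := mid w' a w'ws aw'.
    case/or3P=> [/eqP aE|/eqP aE|aw]; try by rewrite aE ?xB ?yB in aB.
    by rewrite (uniq_flatten_inj um wws w'ws aw aw').
  case/negP; move: cw; rewrite in_setU in_set /walk_of in_cons mem_rcons in_cons.
  case/or3P=> [/eqP->|/eqP->|cw]; rewrite ?ends ?xD //.
  by apply/orP; right; apply/hasP; exists w; rewrite ?xD.
- move=> _ /mapP[w wws ->] /=; have [p ue xB yB] := parts w wws.
  exists w.1.1, w.2; split=> // xy; move: p ue; rewrite /walk_of -xy.
  (* A closed segment of length 1 would be a loop of [G], and one of length 2 would use the same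
     edge twice. *)
  case: w.1.2 => [|a [|b m]] //=; first by rewrite (@girr G).
  by rewrite /walk_edges /= setUC mem_head.
- by apply/allP=> _ /mapP[_ /mapP[w _ ->] ->].
- by rewrite (perm_has _ usL).
by exists l, M; split=> //; exact: perm_trans lM usL.
Qed.

End SigmaSegments.

(** * The graphs [U L i] *)

Lemma path_iotaP (r : rel nat) a o p :
  path r a (iota o p) <->
  (0 < p -> r a o) /\ (forall k, o <= k -> k.+1 < o + p -> r k k.+1).
Proof.
elim: p a o => [|p IH] a o /=; first by split=> // _; split=> // k; rewrite addn0; lia.
split=> [/andP[rao /IH[h1 h2]]|[h1 h2]].
  split=> // k; rewrite leq_eqVlt => /orP[/eqP<-|ok] kp; first by apply: h1; lia.
  by apply: h2 => //; lia.
rewrite h1 //=; apply/IH; split=> [p0|k ok kp]; first by apply: h2; lia.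
by apply: h2; lia.
Qed.

(** Offsets and lengths of the label blocks of the pendent paths: a recursive form of the indexing
    by [take] and [nth] in [Ude]. *)
Fixpoint blocks o (ps : seq nat) :=
  if ps is p :: ps' then (o, p) :: blocks (o + p) ps' else [::].

Lemma has_blocks (q : nat -> nat -> bool) o ps :
  has (fun j => q (o + sumn (take j ps)) (nth 0 ps j)) (iota 0 (size ps)) =
  has (fun b => q b.1 b.2) (blocks o ps).
Proof.
elim: ps o => //= p ps IH o; rewrite addn0 -IH (iotaDl 1 0) has_map.
by congr (_ || _); apply: eq_has => j /=; rewrite addnA.
Qed.

Lemma blocks_bounds o ps b : b \in blocks o ps -> o <= b.1 /\ b.1 + b.2 <= o + sumn ps.
Proof.
elim: ps o => //= p ps IH o; rewrite in_cons => /orP[/eqP->/=|/IH]; lia.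
Qed.

Lemma flatten_blocks o ps : flatten [seq iota b.1 b.2 | b <- blocks o ps] = iota o (sumn ps).
Proof. by elim: ps o => //= p ps IH o; rewrite IH iotaD. Qed.

Lemma blocks_snd o ps : [seq b.2 | b <- blocks o ps] = ps.
Proof. by elim: ps o => //= p ps IH o; rewrite IH. Qed.

Lemma sumn_nth_rest L i : i < size L -> sumn L = nth 0 L i + sumn (Urest L i).
Proof.
move=> iL; rewrite /Urest sumn_cat -{1}(cat_take_drop i L) (drop_nth 0 iL) sumn_cat /=; lia.
Qed.

Lemma perm_nth_rest L i : i < size L -> perm_eq (nth 0 L i :: Urest L i) L.
Proof.
move=> iL; rewrite /Urest -[X in perm_eq _ X](cat_take_drop i L) (drop_nth 0 iL).
by rewrite -cat1s perm_catCA.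
Qed.

(** Independence is tested along one closed walk around the cycle and one walk per pendent path, all
    starting at vertex 0. *)
Lemma sigma_U L i : i < size L -> 2 < nth 0 L i -> all (leq 1) L ->
  sigma (U L i) = lollipop (nth 0 L i) (Urest L i).
Proof.
move=> iL c3 Lpos; have nE := sumn_nth_rest iL.
have Rpos : all (leq 1) (Urest L i).
  by move: Lpos; rewrite -(perm_all _ (perm_nth_rest iL)) => /andP[].
move: nE Rpos; set R := Urest L i; set c := nth 0 L i => nE Rpos.
have n0 : 0 < sumn L by lia.
pose x0 : gV (U L i) := Ordinal n0.
(* Turns labels into vertices, with default [x0] out of range, so that walks are images of integer
   intervals. *)
pose o k : gV (U L i) := insubd x0 k.
have oK k : k < sumn L -> val (o k) = k by move=> kn; rewrite val_insubd kn.
have valK (z : gV (U L i)) : o (val z) = z by exact: valKd.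
have o0 : o 0 = x0 by rewrite -(valK x0).
have oinj : {in [pred k | k < sumn L] &, injective o}.
  by move=> a b an bn /(congr1 val); rewrite !oK.
pose cyc := map o (iota 1 c.-1).
pose ms := [seq map o (iota b.1 b.2) | b <- blocks c R].
have indE (S : {set gV (U L i)}) :
  independent S = path (sparse S) x0 (rcons cyc x0) && all (fun m => path (sparse S) x0 m) ms.
  pose r := [rel a b | ~~ ((o a \in S) && (o b \in S))].
  have pE l : path (sparse S) x0 (map o l) = path r 0 l by rewrite -o0 path_map.
  have cycE : path (sparse S) x0 (rcons cyc x0) = path r 0 (iota 1 c.-1) && r c.-1 0.
    have -> : rcons cyc x0 = map o (rcons (iota 1 c.-1) 0) by rewrite map_rcons o0.
    rewrite pE rcons_path; congr (_ && r _ _).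
    have -> : c.-1 = c.-2.+1 by lia.
    by rewrite -(addn1 c.-2) iotaD cats1 last_rcons addnC.
  rewrite cycE; have UdeE x y : Ude L i x y =
     [&& x < c, y < c & y == x.+1 %% c] ||
     has (fun b => [&& x == 0, y == b.1 & 0 < b.2] || [&& b.1 <= x, x.+1 == y & y < b.1 + b.2]) (blocks c R).
    by rewrite -(has_blocks (fun o p =>
      [&& x == 0, y == o & 0 < p] || [&& o <= x, x.+1 == y & y < o + p])).
  apply/independentP/andP => [ind|[/andP[/path_iotaP[h1 h2] h3] /allP h4]].
    have rI a b : a < sumn L -> b < sumn L -> a != b -> Ude L i a b -> r a b.
      move=> an bn ab abU; apply/negP=> /andP[aS bS]; have /negP := ind _ _ aS bS; apply.
      by rewrite /= /Uadj /= !oK // ab abU.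
    have rc a b : a < c -> b < c -> a != b -> b = a.+1 %% c -> r a b.
      move=> ac bc ab E; apply: rI; rewrite ?UdeE ?ac ?bc -?E ?eqxx //; lia.
    split.
      apply/andP; split; last by apply: rc; rewrite ?prednK ?modnn //; lia.
      by apply/path_iotaP; split=> [c1|k k1 kc]; apply: rc; rewrite ?modn_small //; lia.
    apply/allP=> m /mapP[[a p] bR ->]; have [/= b1 b2] := blocks_bounds bR.
    rewrite pE; apply/path_iotaP; split=> [p0|k bk kb]; apply: rI; try lia.
      by rewrite UdeE; apply/orP; right; apply/hasP; exists (a, p) => //=; rewrite !eqxx p0.
    by rewrite UdeE; apply/orP; right; apply/hasP; exists (a, p) => //=; rewrite eqxx bk kb orbT.
  have H (x y : gV (U L i)) : x \in S -> y \in S -> ~~ Ude L i x y.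
    move=> xS yS; have rxy : ~~ r x y by rewrite /= !valK xS yS.
    rewrite UdeE; apply: contra rxy => /orP[/and3P[xc yc /eqP yE]|/hasP[[a p] bR /=]].
      have [xc1|xc1] := eqVneq x.+1 c.
        have -> : nat_of_ord x = c.-1 by lia.
        by have -> : nat_of_ord y = 0 by rewrite yE xc1 modnn.
      have {}yE : nat_of_ord y = x.+1 by rewrite yE modn_small //; lia.
      rewrite yE; have [->|xn0] := eqVneq (nat_of_ord x) 0; first by apply: h1; lia.
      by apply: h2; lia.
    have : path (sparse S) x0 (map o (iota a p)) by apply: h4; apply/mapP; exists (a, p).
    rewrite pE => /path_iotaP[g1 g2].
    case/orP=> /and3P[]; first by move=> /eqP-> /eqP->.
    by move=> bx /eqP xy yb; rewrite -xy; apply: g2; rewrite ?xy.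
  move=> x y xS yS; rewrite /= /Uadj negb_and negb_or; apply/orP; right.
  by rewrite !H.
rewrite sigma_sum.
have flat : flatten ms = map o (iota c (sumn R)).
  by rewrite -flatten_blocks map_flatten -map_comp.
have uo a p : a + p <= sumn L -> uniq (map o (iota a p)).
  move=> ap; rewrite map_inj_in_uniq ?iota_uniq // => k l.
  by rewrite !mem_iota => hk hl; apply: oinj; rewrite inE; lia.
have memo a p k : a + p <= sumn L -> k < sumn L -> (o k \in map o (iota a p)) = (a <= k < a + p).
  move=> ap kn; rewrite -mem_iota; apply/mapP/idP => [[l li /oinj ->]|ki] //.
    by move: li; rewrite mem_iota inE; lia.
  by exists k.
have in_cyc z : (z \in cyc) = (0 < val z < c).
  by have zn : val z < sumn L := ltn_ord z; rewrite -{1}(valK z) memo //; move: (val z) zn => k; lia.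
have in_flat z : (z \in flatten ms) = (c <= val z).
  by have zn : val z < sumn L := ltn_ord z; rewrite -{1}(valK z) flat memo //; move: (val z) zn => k; lia.
have eq_x0 z : (z == x0) = (val z == 0) by [].
transitivity (\sum_(S : {set gV (U L i)} | S \subset [set z in flatten ms] :|: ([set z in cyc] :|: [set x0]))
   path (sparse S) x0 (rcons cyc x0) * \prod_(m <- ms) path (sparse S) x0 m).
  apply: eq_big => [S|S _]; last by rewrite prod_nat_of_bool indE mulnb.
  suff -> : [set z in flatten ms] :|: ([set z in cyc] :|: [set x0]) = setT by rewrite subsetT.
  apply/setP=> z; rewrite !inE in_flat in_cyc eq_x0.
  by case: (ltnP (val z) c); case: (posnP (val z)).
(* The pendent paths are summed out first, then the interior of the cycle, as a walk from [x0] to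
   itself; only the state of [x0] remains. *)
rewrite (@sum_pendant_paths _ _ (fun S => path (sparse S) x0 (rcons cyc x0))); first last.
- move=> v; rewrite in_flat => vc S; rewrite sparse_pathU1 //.
  by rewrite inE mem_rcons inE !negb_or eq_x0 in_cyc; lia.
- by move=> v; rewrite in_flat !inE in_cyc eq_x0; lia.
- by rewrite !inE eqxx orbT.
- by rewrite flat uo //; lia.
- apply/allP=> m /mapP[[a p] bR ->]; have : p \in R.
    by rewrite -(blocks_snd c R); apply/mapP; exists (a, p).
  by move/(allP Rpos); case: p {bR}.
rewrite (eq_bigr _ (fun S _ => mulnC _ _)) sum_path; first last.
- move=> v; rewrite in_cyc => vc S; apply: eq_bigr => m _.
  by rewrite mem_setU1_neq // eq_sym eq_x0; lia.
- by move=> v; rewrite in_cyc inE eq_x0; lia.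
- by rewrite in_cyc.
- by rewrite in_cyc.
- by rewrite uo //; lia.
rewrite -(setU0 [set x0]) sum_subsetU1 ?inE // sum_subset0 setU0 !inE eqxx size_map size_iota.
have -> : c.-1.+1 = c by lia.
have pendE x : \prod_(m <- ms) pendant (size m) x = \prod_(l <- R) pendant l x.
  rewrite big_map -[in RHS](blocks_snd c R) big_map; apply: eq_bigr => b _.
  by rewrite size_map size_iota.
by rewrite !pendE /lollipop mulnC [X in _ + X]mulnC.
Qed.

(** * Isomorphism invariance and the choice of the cycle length *)

Lemma sigma_iso (G H : sgraph) : isomorphic G H -> sigma G = sigma H.
Proof.
case=> f [fbij fadj]; have finj := bij_inj fbij; case: (fbij) => g fK gK.
rewrite !sigma_sum (reindex (fun S : {set gV G} => f @: S)) /=; last first.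
  exists (fun S : {set gV H} => g @: S) => S _; rewrite -imset_comp.
    by rewrite (eq_imset (g := id)) ?imset_id.
  by rewrite (eq_imset (g := id)) ?imset_id.
apply: eq_bigr => S _; congr nat_of_bool; apply/independentP/independentP => h x y.
  by move=> /imsetP[a aS ->] /imsetP[b bS ->]; rewrite fadj; exact: h.
by move=> xS yS; rewrite -fadj h // imset_f.
Qed.

Lemma segseq_pos G L : unicyclic G -> has_segseq G L -> all (leq 1) L.
Proof.
move=> uG LG; have [->//|/(segment_system uG LG)[ws [_ lens _ _ _]]] := eqVneq L [::].
by rewrite -(perm_all _ lens); apply/allP=> _ /mapP[w _ ->].
Qed.

(** The bound of [sigma_le_lollipop] has some entry [l] of [L] as its cycle; [lollipop_swap]
    exchanges it with the best entry, which is then a pendent length. *)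
Lemma sigma_le_U (G : sgraph) L i : unicyclic G -> has_segseq G L ->
    i < size L -> 2 < nth 0 L i ->
    {in L, forall l, 2 < l -> better_cycle (nth 0 L i) l} ->
  sigma G <= sigma (U L i).
Proof.
move=> uG LG iL c3 best; have Lpos := segseq_pos uG LG.
rewrite sigma_U //; have pc := perm_nth_rest iL.
have long : has (leq 3) L by apply/hasP; exists (nth 0 L i); rewrite ?mem_nth.
have [l [M [l3 pl /leq_trans->//]]] := sigma_le_lollipop uG LG long.
have lL : l \in L by rewrite -(perm_mem pl) mem_head.
move: (nth 0 L i) (Urest L i) pc c3 (best l lL l3) => c R pc c3 better.
have [lc|lc] := eqVneq l c.
  subst l; rewrite (perm_lollipop _ (M' := R)) // -(perm_cons c).
  by rewrite (perm_trans pl) // perm_sym.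
have cM : c \in M.
  have : c \in l :: M by rewrite (perm_mem pl) -(perm_mem pc) mem_head.
  by rewrite in_cons eq_sym (negPf lc).
have pM := perm_to_rem cM; rewrite (perm_lollipop _ pM).
have /(perm_lollipop c)-> : perm_eq R (l :: rem c M).
  rewrite -(perm_cons c) (perm_trans pc) // perm_sym (perm_trans _ pl) //.
  by rewrite (perm_catCA [:: c] [:: l]) /= perm_cons perm_sym.
by apply: lollipop_swap => //; lia.
Qed.

Theorem theorem6 (L : seq nat)
  (hL : exists G0 : sgraph, unicyclic G0 /\ has_segseq G0 L)
  (hl1 : 3 <= head 0 L) :
  (* (a) *)
  (forall i0, i0 < size L -> ~~ odd (nth 0 L i0) -> 3 <= nth 0 L i0 ->
     (forall j, j < size L -> ~~ odd (nth 0 L j) -> 3 <= nth 0 L j ->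
        nth 0 L i0 <= nth 0 L j) ->
     forall G : sgraph, unicyclic G -> has_segseq G L ->
       sigma G <= sigma (U L i0) /\ (isomorphic G (U L i0) -> sigma G = sigma (U L i0)))
  /\
  (* (b) *)
  ((forall j, j < size L -> 3 <= nth 0 L j -> odd (nth 0 L j)) ->
     forall G : sgraph, unicyclic G -> has_segseq G L ->
       sigma G <= sigma (U L 0) /\ (isomorphic G (U L 0) -> sigma G = sigma (U L 0))).
Proof.
split=> [i iL ev c3 small G uG LG|odds G uG LG]; split; try exact: sigma_iso.
  (* An even cycle beats every odd one, and minimality among the even entries settles the rest. *)
  apply: sigma_le_U => // l lL l3; rewrite /better_cycle (negPf ev).
  case: (boolP (odd l)) => //= el; have jL := lL; rewrite -index_mem in jL.
  by have := small _ jL; rewrite nth_index //; exact.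
have L0 : 0 < size L by case: (L) hl1.
apply: sigma_le_U; rewrite ?nth0 // => l lL l3.
have oddL m : m \in L -> 2 < m -> odd m.
  by move=> mL m3; have := odds (index m L); rewrite index_mem nth_index //; exact.
(* All entries of length at least 3 are odd, so the best one is the largest, which comes first in a
   non-increasing list. *)
have [sL _] := LG; rewrite /better_cycle oddL //; last by case: (L) hl1 => // a s _; exact: mem_head.
rewrite oddL //=; case: L sL lL {hL hl1 LG L0 odds oddL} => //= a s sL.
rewrite in_cons => /orP[/eqP->//|ls].
have gt : transitive geq by move=> x y z yx /leq_trans; apply.
by move/allP: (order_path_min gt sL); apply.
Qed.
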